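(* Let $(\Sigma,\mathcal{B},\mu)$ be a measure space, $H=L^2(\Sigma)$, $V$ a real locally convex topological vector space and $j:V\to L^2(\Sigma)$ a linear, weak-to-weak continuous operator. Assume that $\varphi:V\to\mathbb{R}\cup\{+\infty\}$ is convex, proper, lower semicontinuous and $j$-elliptic, that $j(D(\varphi))$ is dense in $L^2(\Sigma)$, and let $S$ be the semigroup on $L^2(\Sigma)$ generated by $(\varphi,j)$. Then the following assertions are equivalent: (1) The semigroup $S$ is positive. (2) For every $u\in L^2(\Sigma)$ one has $\varphi^H(u^+)\le\varphi^H(u)$. (3) For every $\hat u\in D(\varphi)$ there is a $\hat v\in D(\varphi)$ such that $j(\hat u)^+=j(\hat v)$ and $\varphi(\hat v)\le\varphi(\hat u)$.
   Context: The effective domain of $\varphi$ is $D(\varphi)=\{\varphi<+\infty\}$; $\varphi$ is proper if $D(\varphi)\neq\emptyset$, lower semicontinuous if all sublevels $\{\varphi\le c\}$, $c\in\mathbb{R}$, are closed, and coercive if all sublevels are relatively weakly compact. The functional $\varphi$ is $j$-elliptic if there exists $\omega\ge 0$ such that $\hat u\mapsto\varphi(\hat u)+\frac{\omega}{2}\|j(\hat u)\|_H^2$ is convex and coercive. The $j$-subgradient of $\varphi$ is $$\partial_j\varphi=\Big\{(u,f)\in H\times H \;:\; \exists\,\hat u\in D(\varphi)\text{ with } j(\hat u)=u \text{ and, for every }\hat v\in V,\ \liminf_{t\searrow 0}\frac{\varphi(\hat u+t\hat v)-\varphi(\hat u)}{t}\ge\langle f,j(\hat v)\rangle_H\Big\}.$$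 $\partial\psi$ denotes the classical subgradient of a functional $\psi$ on $H$ (the case $V=H$, $j=I$). $\varphi^H:H\to\mathbb{R}\cup\{+\infty\}$ denotes a convex, proper, lower semicontinuous functional with $\partial_j\varphi\subseteq\partial\varphi^H$; it exists, is unique up to an additive constant, and modulo that constant $\varphi^H(u)=\inf\{\varphi(\hat u): j(\hat u)=u\}$. The semigroup generated by $(\varphi,j)$: for every $u_0\in\overline{j(D(\varphi))}$ $(=L^2(\Sigma)$ here$)$ the problem $\dot u+\partial_j\varphi(u)\ni 0$ a.e. on $(0,\infty)$, $u(0)=u_0$, has a unique solution $u\in C(\mathbb{R}_+;H)\cap W^{1,\infty}_{loc}((0,\infty);H)$, and $S(t)u_0:=u(t)$. $L^2(\Sigma)$ (real-valued) carries the natural almost everywhere ordering, and $u^+=u\vee 0$. The semigroup $S$ is positive if $S(t)u\ge 0$ for every $u\ge 0$ and every $t\ge 0$. *)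

(* Defs.v *)
From HB Require Import structures.
From mathcomp Require Import all_boot all_order all_algebra.
From mathcomp Require Import all_classical all_reals all_analysis.
From mathcomp Require Import measurable_realfun.

Set Implicit Arguments.
Unset Strict Implicit.
Unset Printing Implicit Defensive.

Import Order.TTheory GRing.Theory Num.Theory numFieldNormedType.Exports.

Local Open Scope classical_set_scope.
Local Open Scope ring_scope.

(* The normed space L^2(mu): the library type [LspaceType2 mu] of classes of
   square-integrable functions modulo equality mu-a.e. comes without algebraic
   or topological structure; the structure is supplied here, computed on
   representatives. *)

Section L2_type.
Context d (T : measurableType d) (R : realType) (mu : {measure set T -> \bar R}).

Definition L2fun (u : LspaceType2 mu) : T -> R := u.

Lemma L2fun_Lfun (u : LspaceType2 mu) : L2fun u \in Lfun mu 2%:E.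
Proof.
apply/andP; split; rewrite inE /=; last exact: (@Lebesgue_finite _ _ _ _ _ _ u).
exact: (@measurable_funPT _ _ _ _ (repr (LebesgueSpace.sort u))).
Qed.

Lemma L2_ext (u v : LspaceType2 mu) : L2fun u = L2fun v %[ae mu] -> u = v.
Proof.
move=> uv.
have suv : LebesgueSpace.sort u = LebesgueSpace.sort v.
  have /eqP := introT (ae_eqP (LebesgueSpace.sort u) (LebesgueSpace.sort v)) uv.
  by rewrite !reprK.
case: u v suv {uv} => [u [[u2]]] [v [[v2]]] /= uv.
by case: v / uv v2 => v2; rewrite (Prop_irrelevance u2 v2).
Qed.

Lemma Lnorm2_ae_eq (f g : T -> R) :
  measurable_fun setT f -> measurable_fun setT g -> f = g %[ae mu] ->
  ('N[mu]_2%:E[EFin \o f] = 'N[mu]_2%:E[EFin \o g])%E.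
Proof.
move=> mf mg fg; have mpow (h : T -> R) : measurable_fun setT h ->
    measurable_fun setT ((fun x => `|(EFin \o h) x| `^ 2)%E : T -> \bar R).
  move=> mh; apply/measurable_EFinP.
  by apply: (measurableT_comp (measurable_powR _)); exact: measurableT_comp.
rewrite unlock /Lnorm; congr (_ `^ _)%E.
apply: ge0_ae_eq_integral; [by []|exact: mpow|exact: mpow| | |].
- by move=> x _; exact: poweR_ge0.
- by move=> x _; exact: poweR_ge0.
- by apply: filterS fg => x /(_ I) /= fgx _; rewrite fgx.
Qed.

Section class_of.
Variables (f : T -> R) (f2 : f \in Lfun mu 2%:E).

Let mf : measurable_fun setT f.
Proof. by move: f2 => /andP[+ _]; rewrite inE. Qed.

Let f_mfun : {mfun T >-> measurableTypeR R} :=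
  MeasurableFun.Pack (MeasurableFun.Class
    (@isMeasurableFun.Build _ _ T (measurableTypeR R) f mf)).
Let cf : {mfun_ mu, T >-> measurableTypeR R} :=
  \pi_({mfun_ mu, T >-> measurableTypeR R})%qT f_mfun.

Let cfE : (cf : T -> R) = f %[ae mu].
Proof.
have : (repr cf == f_mfun %[mod {mfun_ mu, T >-> measurableTypeR R}])%qT.
  by rewrite reprK.
by rewrite eqmodE => /asboolP.
Qed.

Let cf_finite : finite_norm mu 2%:E (cf : T -> R).
Proof.
have /andP[_] := f2; rewrite inE /= => nf.
rewrite /finite_norm (@Lnorm2_ae_eq _ f)//.
exact: (@measurable_funPT _ _ _ _ (repr cf)).
Qed.

Definition L2class : LspaceType2 mu :=
  LebesgueSpace.Pack
    (LebesgueSpace.Class (@isFinLebesgue.Build _ _ _ mu _ (lee1n 2) cf cf_finite)).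

Lemma L2classE : L2fun L2class = f %[ae mu].
Proof. exact: cfE. Qed.

End class_of.
End L2_type.

Section L2_normedModType.
Context d (T : measurableType d) (R : realType) (mu : {measure set T -> \bar R}).
Local Notation L2 := (LspaceType2 mu).
Implicit Types (u v w : L2) (a : R).

HB.instance Definition _ := gen_eqMixin L2.
HB.instance Definition _ := gen_choiceMixin L2.

Let Lfun2_closed := @Lfun_submod_closed _ T R mu 2%:E (lee1n 2).

Lemma L2zero_subproof : cst 0 \in Lfun mu (2%:E : \bar R).
Proof. by have [] := Lfun2_closed. Qed.

Lemma L2lin_subproof a u v : (fun x => a * L2fun u x + L2fun v x) \in Lfun mu 2%:E.
Proof. by have [_] := Lfun2_closed; apply; exact: L2fun_Lfun. Qed.

Definition L2zero : L2 := L2class L2zero_subproof.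
Definition L2lin a u v : L2 := L2class (L2lin_subproof a u v).
Definition L2opp u := L2lin (-1) u L2zero.
Definition L2add u v := L2lin 1 u v.
Definition L2scale a u := L2lin a u L2zero.

Lemma L2zeroE : {ae mu, forall x, L2fun L2zero x = 0}.
Proof. by apply: filterS (L2classE L2zero_subproof) => x /(_ I). Qed.

Lemma L2linE a u v :
  {ae mu, forall x, L2fun (L2lin a u v) x = a * L2fun u x + L2fun v x}.
Proof. by apply: filterS (L2classE (L2lin_subproof a u v)) => x /(_ I). Qed.

Lemma L2addE u v : {ae mu, forall x, L2fun (L2add u v) x = L2fun u x + L2fun v x}.
Proof. by apply: filterS (L2linE 1 u v) => x ->; rewrite mul1r. Qed.

Lemma L2scaleE a u : {ae mu, forall x, L2fun (L2scale a u) x = a * L2fun u x}.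
Proof.
by apply: filterS2 L2zeroE (L2linE a u L2zero) => x x0 ->; rewrite x0 addr0.
Qed.

Lemma L2oppE u : {ae mu, forall x, L2fun (L2opp u) x = - L2fun u x}.
Proof. by apply: filterS (L2scaleE (-1) u) => x ->; rewrite mulN1r. Qed.

Lemma L2_aeP u v : {ae mu, forall x, L2fun u x = L2fun v x} -> u = v.
Proof. by move=> uv; apply: L2_ext; apply: filterS uv => x ->. Qed.

Let ae_eq2 u v (f : T -> R) : {ae mu, forall x, L2fun u x = f x} ->
  {ae mu, forall x, L2fun v x = f x} -> u = v.
Proof. by move=> uf vf; apply: L2_aeP; apply: filterS2 uf vf => x -> ->. Qed.

Lemma L2addA : associative L2add.
Proof.
move=> u v w.
apply: (@ae_eq2 _ _ (fun x => L2fun u x + L2fun v x + L2fun w x)).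
- by apply: filterS2 (L2addE u (L2add v w)) (L2addE v w) => x -> ->; rewrite addrA.
- by apply: filterS2 (L2addE (L2add u v) w) (L2addE u v) => x -> ->.
Qed.

Lemma L2addC : commutative L2add.
Proof.
move=> u v; apply: (ae_eq2 (L2addE u v)).
by apply: filterS (L2addE v u) => x ->; rewrite addrC.
Qed.

Lemma L2add0 : left_id L2zero L2add.
Proof.
move=> u; apply: L2_aeP; apply: filterS2 (L2addE L2zero u) L2zeroE => x -> ->.
by rewrite add0r.
Qed.

Lemma L2addN : left_inverse L2zero L2opp L2add.
Proof.
move=> u; apply: (ae_eq2 _ L2zeroE).
by apply: filterS2 (L2addE (L2opp u) u) (L2oppE u) => x -> ->; rewrite addNr.
Qed.

HB.instance Definition _ :=
  GRing.isZmodule.Build L2 L2addA L2addC L2add0 L2addN.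

Lemma L2scaleA a b u : L2scale a (L2scale b u) = L2scale (a * b) u.
Proof.
apply: (ae_eq2 _ (L2scaleE (a * b) u)).
apply: filterS2 (L2scaleE a (L2scale b u)) (L2scaleE b u) => x -> ->.
by rewrite mulrA.
Qed.

Lemma L2scale1 : left_id 1 L2scale.
Proof.
by move=> u; apply: L2_aeP; apply: filterS (L2scaleE 1 u) => x ->; rewrite mul1r.
Qed.

Lemma L2scaleDr : right_distributive L2scale +%R.
Proof.
move=> a u v; apply: (@ae_eq2 _ _ (fun x => a * (L2fun u x + L2fun v x))).
- by apply: filterS2 (L2scaleE a (L2add u v)) (L2addE u v) => x -> ->.
- apply: filterS3 (L2addE (L2scale a u) (L2scale a v))
    (L2scaleE a u) (L2scaleE a v) => x -> -> ->.
  by rewrite mulrDr.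
Qed.

Lemma L2scaleDl u : {morph L2scale^~ u : a b / a + b}.
Proof.
move=> a b; apply: (ae_eq2 (L2scaleE (a + b) u)).
apply: filterS3 (L2addE (L2scale a u) (L2scale b u))
  (L2scaleE a u) (L2scaleE b u) => x -> -> ->.
by rewrite mulrDl.
Qed.

HB.instance Definition _ := GRing.Zmodule_isLmodule.Build R L2
  L2scaleA L2scale1 L2scaleDr L2scaleDl.

Definition L2norm u : R := fine 'N[mu]_2%:E[EFin \o L2fun u]%E.

Let L2normE u (f : LfunType mu (lee1n 2)) :
  {ae mu, forall x, L2fun u x = f x} -> L2norm u = fine 'N[mu]_2%:E[EFin \o f]%E.
Proof.
move=> uf; congr fine; apply: Lnorm2_ae_eq.
- by have /andP[+ _] := L2fun_Lfun u; rewrite inE.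
- exact: measurable_funPT.
- by apply: filterS uf => x ->.
Qed.

Let Lf u := Lfun_Sub (lee1n 2) (L2fun_Lfun u).

Lemma ler_L2normD u v : L2norm (u + v) <= L2norm u + L2norm v.
Proof.
rewrite (@L2normE (u + v) (Lf u + Lf v)); last exact: L2addE.
exact: ler_LnormD.
Qed.

Lemma L2normZ a u : L2norm (a *: u) = `|a| * L2norm u.
Proof.
rewrite (@L2normE (a *: u) (a *: Lf u)); last exact: L2scaleE.
rewrite LnormZ fineM//.
by rewrite -(finite_norm_fine (Lf u)).
Qed.

Lemma L2norm_eq0 u : L2norm u = 0 -> u = 0.
Proof.
move=> /(@fine_Lnormr_eq0 _ _ _ mu _ (lee1n 2) (Lf u)) u0.
by apply: (ae_eq2 _ L2zeroE); apply: filterS u0 => x /(_ I).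
Qed.

HB.instance Definition _ :=
  Lmodule_isNormed.Build R L2 ler_L2normD L2normZ L2norm_eq0.

End L2_normedModType.

Section L2_inner_order.
Context d (T : measurableType d) (R : realType) (mu : {measure set T -> \bar R}).
Local Notation L2 := (LspaceType2 mu).
Implicit Types u v : L2.

Definition L2dot u v : R := \int[mu]_x (L2fun u x * L2fun v x).

Definition L2nonneg u := {ae mu, forall x, 0 <= L2fun u x}.

Lemma L2pos_subproof u : (L2fun u)^\+ \in Lfun mu 2%:E.
Proof.
have /andP[mu_ nu] := L2fun_Lfun u; rewrite !inE /= in mu_ nu.
have aL : Num.norm \o L2fun u \in Lfun mu 2%:E.
  apply/andP; split; rewrite inE /=; first exact: measurableT_comp.
  rewrite /finite_norm.
  under [X in ('N[_]__[X])%E]eq_fun => x do rewrite -abse_EFin.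
  by rewrite Lnorm_abse.
have [z cl] := @Lfun_submod_closed _ T R mu 2%:E (lee1n 2).
have h2 := cl 2^-1 _ _ (cl 1 _ _ (L2fun_Lfun u) aL) z.
suff -> : (L2fun u)^\+ =
    2^-1 *: (1 *: (L2fun u : T -> R^o) + (Num.norm \o L2fun u)) + cst 0.
  exact: h2.
apply/funext => x; rewrite addr0 scale1r.
transitivity (2^-1 * (L2fun u x + `|L2fun u x|)); last by [].
rewrite /funrpos.
case: (leP (L2fun u x) 0) => [u0|/ltW u0].
- by rewrite ler0_norm// subrr mulr0.
- by rewrite ger0_norm// mulrDr !(mulrC 2^-1) -splitr.
Qed.

Definition L2pos u : L2 := L2class (L2pos_subproof u).

End L2_inner_order.

Section extended_valued_functionals.
Context (R : realType) (V : lmodType R).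
Implicit Types phi : V -> \bar R.
Local Open Scope ereal_scope.

Definition effdom phi : set V := [set v | phi v < +oo].

(* A functional with values in R `|` {+oo}, not identically +oo. *)
Definition proper_functional phi := (forall v, phi v != -oo) /\ effdom phi !=set0.

(* For a functional avoiding -oo, the products are unambiguous: in [\bar R],
   0 * +oo = 0. *)
Definition convex_functional phi := forall (x y : V) (t : R),
  (0 <= t <= 1)%R ->
  phi (t *: x + (1 - t) *: y)%R <= t%:E * phi x + (1 - t)%:E * phi y.

End extended_valued_functionals.

Section weak_topology.
Context (R : realType) (V : tvsType R).

Definition tvs_dual := {f : {linear V -> R^o} | continuous f}.

Definition weak_tvs := sup_topology (fun f : tvs_dual =>
  Topological.on (initial_topology (sval f : V -> R^o))).

HB.instance Definition _ := Topological.on weak_tvs.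

Definition coercive (phi : V -> \bar R) := forall c : R,
  precompact ([set v | (phi v <= c%:E)%E] : set weak_tvs).

End weak_topology.

Definition weak_to_weak_continuous (R : realType) (V W : tvsType R)
  (f : V -> W) := continuous (f : weak_tvs V -> weak_tvs W).

Section j_subgradient.
Context d (T : measurableType d) (R : realType) (mu : {measure set T -> \bar R}).
Local Notation L2 := (LspaceType2 mu).

Definition j_elliptic (V : tvsType R) (j : V -> L2) (phi : V -> \bar R) :=
  exists omega : R, 0 <= omega /\
    let phi_omega v := (phi v + (omega / 2 * `|j v| ^+ 2)%:E)%E in
    convex_functional phi_omega /\ coercive phi_omega.

Definition j_subgrad (V : lmodType R) (j : V -> L2) (phi : V -> \bar R) :
    set (L2 * L2) :=
  [set uf | exists uh, [/\ effdom phi uh, j uh = uf.1 &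
    forall vh,
      ((L2dot uf.2 (j vh))%:E <=
       limf_einf (fun t : R => (phi (uh + t *: vh)%R - phi uh) * t^-1%:E) 0^'+)%E]].

Definition subgrad (psi : L2 -> \bar R) : set (L2 * L2) := j_subgrad id psi.

(* The functionals written phi^H: any of them, as they differ by constants. *)
Definition is_phiH (V : lmodType R) (j : V -> L2) (phi : V -> \bar R)
    (phiH : L2 -> \bar R) :=
  [/\ convex_functional phiH, proper_functional phiH, lower_semicontinuous phiH &
      j_subgrad j phi `<=` subgrad phiH].

End j_subgradient.

(* Functions of time are defined on all of [R]; only their values on the
   positive half-line matter. *)
Section evolution.
Context d (T : measurableType d) (R : realType) (mu : {measure set T -> \bar R}).
Local Notation L2 := (LspaceType2 mu).
Local Notation leb := (@lebesgue_measure R).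
Implicit Types u g s : R -> L2.

Definition simple_fun s :=
  finite_set (range s) /\
  forall h, measurable (s @^-1` [set h] : set (measurableTypeR R)).

Definition strongly_measurable g := exists s : nat -> R -> L2,
  (forall n, simple_fun (s n)) /\
  {ae leb, forall t, 0 < t -> s ^~ t @ \oo --> g t}.

Definition Linfty_loc g :=
  strongly_measurable g /\
  forall a b : R, 0 < a -> a < b -> exists M : R,
    {ae leb, forall t, a <= t <= b -> `|g t| <= M}.

(* C^1 functions with compact support in the open half-line. *)
Definition test_fun (psi : R -> R) :=
  [/\ forall t, derivable psi t 1, continuous (derive1 psi) &
      exists a b : R, 0 < a /\ forall t, ~~ (a <= t <= b) -> psi t = 0].

(* The identity  int psi' u = - int psi g  between Bochner integrals with
   values in L^2(mu), tested against the vectors h of L^2(mu). *)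
Definition weak_derivative u g := forall psi, test_fun psi -> forall h : L2,
  \int[leb]_(t in `]0, +oo[) (derive1 psi t * L2dot (u t) h) =
  - \int[leb]_(t in `]0, +oo[) (psi t * L2dot (g t) h).

(* u is in W^{1,infty}_loc((0,infty); L^2(mu)) with derivative g. *)
Definition W1infty_loc u g :=
  [/\ Linfty_loc u, Linfty_loc g & weak_derivative u g].

Definition is_solution (V : lmodType R) (j : V -> L2) (phi : V -> \bar R)
    (u0 : L2) u :=
  [/\ {within `[0, +oo[, continuous u}, u 0 = u0 &
      exists g, W1infty_loc u g /\
        {ae leb, forall t, 0 < t -> j_subgrad j phi (u t, - g t)}].

Definition generated_by (V : lmodType R) (j : V -> L2) (phi : V -> \bar R)
    (S : R -> L2 -> L2) :=
  forall u0 : L2, closure (j @` effdom phi) u0 -> is_solution j phi u0 (S ^~ u0).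

Definition positive_semigroup (S : R -> L2 -> L2) :=
  forall (t : R) (u : L2), 0 <= t -> L2nonneg u -> L2nonneg (S t u).

End evolution.

(* Main.v *)
Require Import Defs.
From HB Require Import structures.
From mathcomp Require Import all_boot all_order all_algebra.
From mathcomp Require Import all_classical all_reals all_analysis.
From mathcomp Require Import measurable_realfun.
From mathcomp Require Import ring lra.

Set Implicit Arguments.
Unset Strict Implicit.
Unset Printing Implicit Defensive.

Import Order.TTheory GRing.Theory Num.Theory numFieldNormedType.Exports.

Local Open Scope classical_set_scope.
Local Open Scope ring_scope.

(** The statement splits into an equivalence about the flow and one about phi.

    Flow.  Along a trajectory w of S one has - w' in the subgradient of phiH at
    w for almost every time.  Write u+ and u- for the positive and negative
    parts, so that u = u+ - u-.  If phiH (u+) <= phiH u for all u, testing the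
    inclusion in the direction w+ - w = w- gives <w', w-> >= 0; since - w- is
    the gradient of |w-|^2 / 2, this quantity does not increase, and the positive
    cone is invariant ([solution_nonneg]).  Conversely, suppose that
    phiH u < phiH (u+) and let w start at u+.  By lower semicontinuity phiH w
    stays above phiH u by a fixed margin for small times, so the inclusion tested
    in the direction u - w makes |w - u| decrease strictly; but w stays in the
    cone, and u+ is the point of the cone nearest to u ([positive_functional]).

    Both arguments need the chain rule for a function of w with Lipschitz
    gradient, while w only has a weak derivative.  It is replaced by an estimate
    on increments: freezing the gradient at the end of a short time interval
    costs an error quadratic in the length of the interval, and such errors
    disappear when a partition is refined ([quadratic_increment_le],
    [W1infty_dissipation]).  With the gradient frozen, only increments of the
    scalar functions <w, h> matter, and these are controlled by testing the weak
    derivative against a C^1 trapezoid ([mean_value_le]).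

    Functional.  Up to a constant, phiH is the infimum of phi over the fibres of
    j, and the infimum is attained ([phiH_is_infimum]); the equivalence of the
    second and third assertions is then immediate.  For k large,
    phi + k |j - x|^2 has a minimizer ([minimizer_exists]); it is a point uh with
    a subgradient f such that x = j uh + f / (2k).  For two such points, with
    the same k, the gap phiH (j uh) - phi uh changes by at most k/2 times the
    square of the distance of the corresponding x, because phiH and phi have a
    subgradient in common at each of them; so the gap is a constant, again by
    refining a partition ([gap_constant]).  As k tends to infinity, j uh tends to
    x and the identity extends from these points to all of H.

    The minimizers, and the limit of the uh, come from weak compactness.  This
    requires closed convex sets to be weakly closed ([weakly_closed_convex]),
    hence the Hahn-Banach theorem, which is deduced from the fact that a minimal
    sublinear functional is linear. *)

(** * Sublinear functionals and the Hahn-Banach theorem *)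

Definition sublinear (R : realType) (V : lmodType R) (p : V -> R) :=
  (forall x y, p (x + y) <= p x + p y) /\
  (forall t x, 0 < t -> p (t *: x) <= t * p x).

Lemma inf_le_infD (R : realType) (A B C : set R) :
  A !=set0 -> B !=set0 -> has_lbound C ->
  (forall a b, A a -> B b -> exists2 c, C c & c <= a + b) ->
  inf C <= inf A + inf B.
Proof.
move=> A0 B0 lC ABC; rewrite -lerBlDl; apply: lb_le_inf => // b Bb.
rewrite lerBlDl -lerBlDr; apply: lb_le_inf => // a Aa.
have [c Cc cab] := ABC _ _ Aa Bb.
by rewrite lerBlDr (le_trans _ cab)//; exact: ge_inf.
Qed.

Lemma inf_le_infM (R : realType) (A C : set R) (t : R) :
  0 < t -> A !=set0 -> has_lbound C ->
  (forall a, A a -> exists2 c, C c & c <= t * a) -> inf C <= t * inf A.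
Proof.
move=> t0 A0 lC AC; rewrite -ler_pdivrMl//; apply: lb_le_inf => // a Aa.
have [c Cc ca] := AC _ Aa.
by rewrite ler_pdivrMl// (le_trans _ ca)//; exact: ge_inf.
Qed.

Section sublinear_functionals.
Context (R : realType) (V : lmodType R).
Implicit Types p q : V -> R.

Lemma sublinear0 p : sublinear p -> p 0 = 0.
Proof.
move=> [pD pZ]; have := pD 0 0; have := pZ 2^-1 0 ltac:(by []).
rewrite scaler0 addr0; lra.
Qed.

Lemma sublinearN p x : sublinear p -> - p (- x) <= p x.
Proof.
by move=> sp; have [pD _] := sp; have := pD x (- x);
  rewrite subrr sublinear0//; lra.
Qed.

(** The largest sublinear functional below p whose slope in the direction - y is
    at most - p y.  It serves twice: a minimal p equals all its tilts, hence is
    additive, and a linear functional below the tilt along x0 equals p x0 at x0. *)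
Definition tilt p y x := inf [set p (x + t *: y) - t * p y | t in [set t | 0 <= t]].

Section tilt.
Variables (p : V -> R) (y : V).
Hypothesis sp : sublinear p.

Let tilt_neq0 x : [set p (x + t *: y) - t * p y | t in [set t | 0 <= t]] !=set0.
Proof. by exists (p (x + 0 *: y) - 0 * p y); exists 0 => /=. Qed.

Let tilt_lb x :
  has_lbound [set p (x + t *: y) - t * p y | t in [set t | 0 <= t]].
Proof.
exists (- p (- x)) => _ [t /= t0 <-].
have := sp.1 (x + t *: y) (- x); rewrite addrAC subrr add0r.
have : t * p y <= p (t *: y).
  move: t0; rewrite le_eqVlt => /predU1P[<-|t0].
    by rewrite scale0r mul0r sublinear0.
  have := sp.2 t^-1 (t *: y); rewrite invr_gt0 => /(_ t0).
  by rewrite scalerA mulVf ?gt_eqF// scale1r ler_pdivlMl.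
lra.
Qed.

Lemma tilt_ge t x : 0 <= t -> tilt p y x <= p (x + t *: y) - t * p y.
Proof. by move=> t0; apply: ge_inf => //; exists t. Qed.

Lemma tilt_le x : tilt p y x <= p x.
Proof. by have := @tilt_ge 0 x (lexx _); rewrite scale0r mul0r addr0 subr0. Qed.

Lemma tilt_sublinear : sublinear (tilt p y).
Proof.
split => [x z|t x t0].
- apply: inf_le_infD => // _ _ [s /= s0 <-] [t /= t0 <-].
  exists (p (x + z + (s + t) *: y) - (s + t) * p y).
    by exists (s + t) => //=; rewrite addr_ge0.
  have := sp.1 (x + s *: y) (z + t *: y); rewrite addrACA -scalerDl.
  rewrite mulrDl; lra.
- apply: inf_le_infM => // _ [s /= s0 <-].
  exists (p (t *: x + (t * s) *: y) - (t * s) * p y).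
    by exists (t * s) => //=; rewrite mulr_ge0// ltW.
  by have := sp.2 t (x + s *: y) t0; rewrite scalerDr scalerA; lra.
Qed.

End tilt.

(** Minimality gives p x <= tilt p y x <= p (x + y) - p y, which is the missing
    half of additivity. *)
Lemma minimal_sublinear_linear p : sublinear p ->
  (forall q, sublinear q -> (forall x, q x <= p x) -> forall x, p x <= q x) ->
  forall a x y, p (a *: x + y) = a * p x + p y.
Proof.
move=> sp pmin.
have pD x y : p (x + y) = p x + p y.
  apply/eqP; rewrite eq_le sp.1/=.
  have := pmin _ (tilt_sublinear y sp) (tilt_le y sp) x.
  by have := tilt_ge y sp x ler01; rewrite scale1r mul1r; lra.
have pN x : p (- x) = - p x.
  by have := pD x (- x); rewrite subrr sublinear0//; lra.
have pZ t x : 0 < t -> p (t *: x) = t * p x.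
  move=> t0; apply/eqP; rewrite eq_le sp.2//=.
  have := sp.2 t (- x) t0; rewrite scalerN !pN; lra.
move=> a x y; rewrite pD; congr (_ + _).
have [a0|a0|->] := ltgtP a 0; last by rewrite scale0r mul0r sublinear0.
- by rewrite -[a]opprK scaleNr pN pZ ?oppr_gt0// !mulNr.
- exact: pZ.
Qed.

(** Zorn's lemma is applied to the sublinear functionals below tilt p x0, ordered
    downwards: the pointwise infimum of a chain is sublinear, and it is finite
    because r x >= - q (- x) for every r <= q. *)
Theorem Hahn_Banach p (x0 : V) : sublinear p ->
  exists f : {linear V -> R^o}, (forall x, f x <= p x) /\ f x0 = p x0.
Proof.
move=> sp.
pose q := tilt p x0; have sq : sublinear q := tilt_sublinear x0 sp.
pose T := {r : V -> R | sublinear r /\ forall x, r x <= q x}.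
have q0 : T by exists q.
pose le (r s : T) := `[< forall x, sval s x <= sval r x >].
have [|||[r [sr rq]] rmin] := @ZL_preorder T q0 le.
- by move=> r; apply/asboolP => x.
- move=> r s t /asboolP rs /asboolP st; apply/asboolP => x.
  exact: le_trans (st x) (rs x).
- move=> F totF; have [[r0 Fr0]|F0] := pselect (F !=set0); last first.
    by exists q0 => s Fs; exfalso; apply: F0; exists s.
  pose i x := [set sval r x | r in F].
  have i0 x : i x !=set0 by exists (sval r0 x); exists r0.
  have lb x : has_lbound (i x).
    exists (- q (- x)) => _ [r Fr <-]; have [sr rq] := svalP r.
    by apply: le_trans (sublinearN x sr); rewrite lerN2.
  have si : sublinear (fun x => inf (i x)).
    split => [x y|t x t0].
    + apply: inf_le_infD => // _ _ [r Fr <-] [s Fs <-].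
      have [/asboolP les|/asboolP ler] := totF _ _ Fr Fs.
      * exists (sval s (x + y)); first by exists s.
        by apply: le_trans ((svalP s).1.1 x y) _; rewrite lerD2r.
      * exists (sval r (x + y)); first by exists r.
        by apply: le_trans ((svalP r).1.1 x y) _; rewrite lerD2l.
    + apply: inf_le_infM => // _ [r Fr <-].
      by exists (sval r (t *: x)); [exists r|exact: (svalP r).1.2].
  have iq x : inf (i x) <= q x.
    by apply: le_trans ((svalP r0).2 x); apply: ge_inf => //; exists r0.
  exists (exist _ (fun x => inf (i x)) (conj si iq)) => s Fs.
  by apply/asboolP => x /=; apply: ge_inf => //; exists s.
have rlin : linear (r : V -> R^o).
  apply: minimal_sublinear_linear => // s ss les x.
  have sq' x' : s x' <= q x' := le_trans (les x') (rq x').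
  have /= := rmin (exist _ s (conj ss sq')); rewrite /le/=.
  by move=> /(_ _)/asboolP; apply; apply/asboolP.
pose rL := GRing.isLinear.Build _ _ _ _ (r : V -> R^o) rlin.
pose f : {linear V -> R^o} := HB.pack (r : V -> R^o) rL.
have fp x : f x <= p x := le_trans (rq x) (tilt_le x0 sp x).
exists f; split => //; apply/eqP; rewrite eq_le fp /=.
have := rq (- x0); have := tilt_ge x0 sp (- x0) ler01.
rewrite scale1r addNr sublinear0// mul1r sub0r.
have -> : r (- x0) = - f x0 by rewrite -raddfN.
by rewrite -/q => qx0 fq; rewrite -lerN2; exact: le_trans fq qx0.
Qed.

End sublinear_functionals.

(** * Weak closedness of closed convex sets *)

Section gauge.
Context (R : realType) (V : lmodType R).
Implicit Types (C K : set V) (x y : V) (t : R).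

Definition is_convex C := forall x y t,
  0 <= t <= 1 -> C x -> C y -> C (t *: x + (1 - t) *: y).

Definition gauge K x := inf [set t | 0 < t /\ K (t^-1 *: x)].

Variable K : set V.
Hypotheses (K_convex : is_convex K)
  (K_absorbing : forall x, exists2 t, 0 < t & K (t^-1 *: x)).

Let gauge_neq0 x : [set t | 0 < t /\ K (t^-1 *: x)] !=set0.
Proof. by have [t] := K_absorbing x; exists t. Qed.

Let gauge_lb x : has_lbound [set t | 0 < t /\ K (t^-1 *: x)].
Proof. by exists 0 => t [/ltW]. Qed.

Lemma gauge_sublinear : sublinear (gauge K).
Proof.
split => [x y|t x t0].
- apply: inf_le_infD => // s t [s0 Ks] [t0 Kt]; exists (s + t) => //.
  have st0 : 0 < s + t by rewrite addr_gt0.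
  split => //; have := K_convex (t := s / (s + t)) _ Ks Kt.
  have -> : s / (s + t) *: (s^-1 *: x) + (1 - s / (s + t)) *: (t^-1 *: y) =
      (s + t)^-1 *: (x + y).
    rewrite !scalerA scalerDr; congr (_ *: _ + _ *: _); field;
    by rewrite ?gt_eqF.
  apply; apply/andP; split; first by rewrite divr_ge0// ltW.
  by rewrite ler_pdivrMr// mul1r lerDl ltW.
- apply: inf_le_infM => // a [a0 Ka]; exists (t * a) => //.
  split; first exact: mulr_gt0.
  by rewrite invfM scalerA mulrAC mulVf ?mul1r ?gt_eqF.
Qed.

Lemma gauge_le1 x : K x -> gauge K x <= 1.
Proof. by move=> Kx; apply: ge_inf => //; rewrite /= invr1 scale1r. Qed.

Lemma gauge_ge1 x : ~ K x -> 1 <= gauge K x.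
Proof.
move=> nKx; apply: lb_le_inf => // t [t0 Kt]; rewrite leNgt; apply/negP => t1.
have [s _ K0] := K_absorbing 0; rewrite scaler0 in K0.
apply: nKx; have := K_convex (t := t) _ Kt K0.
by rewrite scalerA divff ?gt_eqF// scale1r scaler0 addr0; apply; rewrite !ltW.
Qed.

End gauge.

Section weakly_closed_convex.
Context (R : realType) (V : tvsType R).
Implicit Types (C U : set V) (x v : V).

Lemma nbhsD v x U : nbhs (v + x) U -> nbhs x [set y | U (v + y)].
Proof.
move=> /(@add_continuous V (v, x))[[A B] /= [Av Bx] AB].
apply: filterS Bx => y By; apply: (AB (v, y)); split => //=.
exact: nbhs_singleton.
Qed.

Lemma nbhsZl (a : R) x U : nbhs (a *: x) U -> nbhs x [set y | U (a *: y)].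
Proof.
move=> /(@scale_continuous R V (a, x))[[A B] /= [Aa Bx] AB].
apply: filterS Bx => y By; apply: (AB (a, y)); split => //=.
exact: nbhs_singleton.
Qed.

Lemma nbhsZr (a : R) x U : nbhs (a *: x) U -> \forall t \near a, U (t *: x).
Proof.
move=> /(@scale_continuous R V (a, x))[[A B] /= [Aa Bx] AB].
apply: filterS Aa => t At; apply: (AB (t, x)); split => //=.
exact: nbhs_singleton.
Qed.

(** Neighbourhoods of 0 are absorbing. *)
Lemma nbhs0_scale_pos x U : nbhs 0 U -> exists2 t : R, 0 < t & U (t *: x).
Proof.
rewrite -(scale0r x) => /nbhsZr/nbhs_ballP[e /= e0 eU]; exists (e / 2).
  by rewrite divr_gt0.
apply: eU; rewrite /ball /= sub0r normrN gtr0_norm ?divr_gt0//.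
by rewrite ltr_pdivrMr// ltr_pMr// ltr1n.
Qed.

Lemma nbhs0_convex U : nbhs 0 U -> exists D : set V,
  [/\ nbhs 0 D, is_convex D & D `<=` U].
Proof.
move=> U0; have [B Bconv [Bopen Bbase]] := @locally_convex R V.
have [D [BD D0] DU] := Bbase 0 U U0; exists D; split => //.
  by apply: open_nbhs_nbhs; split => //; exact: Bopen.
move=> x y t /andP[t0 t1] Dx Dy.
have := Bconv D (mem_set BD) x y (Itv01 t0 t1) (mem_set Dx) (mem_set Dy).
by rewrite inE.
Qed.

(** By homogeneity |f| <= e on e (U meet - U), which is a neighbourhood of 0. *)
Lemma linear_continuous_of_bound (f : {linear V -> R^o}) U :
  nbhs 0 U -> (forall x, U x -> f x <= 1) -> continuous f.
Proof.
move=> U0 fU x; apply/cvgrPdist_le => e e0.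
have U0' : nbhs 0 [set y | U (- y)].
  have := @nbhsZl (-1) 0 U; rewrite scaler0 => /(_ U0).
  by apply: filterS => y /=; rewrite scaleN1r.
pose W := U `&` [set y | U (- y)]; have W0 : nbhs 0 W by exact: filterI.
have W0e : nbhs 0 [set y | W (e^-1 *: y)].
  by have := @nbhsZl e^-1 0 W; rewrite scaler0; apply.
have Wx : nbhs x [set y | W (e^-1 *: (- x + y))].
  by have := @nbhsD (- x) x [set y | W (e^-1 *: y)]; rewrite addNr; apply.
apply: filterS Wx => y /= [Wy1 Wy2].
have fE z : f (e^-1 *: z) = e^-1 * f z by rewrite linearZ.
have fB : f (- x + y) = f y - f x by rewrite addrC linearB.
have := fU _ Wy1; have := fU _ Wy2; rewrite linearN /= fE fB -mulrN.
rewrite !ler_pdivrMl// !mulr1 => h1 h2.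
by rewrite ler_norml; apply/andP; split; lra.
Qed.

(** Let U be a convex neighbourhood of 0 such that v + U misses C, and c0 a point
    of C.  Then K = U - C + c0 is a convex neighbourhood of 0 without c0 - v, and
    the functional given by the Hahn-Banach theorem for the gauge of K is at most
    1 on K and at least 1 at c0 - v. *)
Lemma closed_convex_separation C v : closed C -> is_convex C -> C !=set0 ->
  ~ C v -> exists (f : tvs_dual V) (a : R),
    sval f v < a /\ forall x, C x -> a <= sval f x.
Proof.
move=> Ccl Cconv [c0 Cc0] nCv.
have nv : nbhs v (~` C) by apply: open_nbhs_nbhs; split => //; exact: closed_openC.
have nv0 : nbhs (v + 0) (~` C) by rewrite addr0.
have [U [U0 Uconv UC]] := nbhs0_convex (nbhsD nv0).
pose K := [set z | exists u c, [/\ U u, C c & z = u - c + c0]].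
have UK : U `<=` K by move=> u Uu; exists u, c0; rewrite subrK.
have Kconv : is_convex K.
  move=> _ _ t t01 [u [c [Uu Cc ->]]] [u' [c' [Uu' Cc' ->]]].
  exists (t *: u + (1 - t) *: u'), (t *: c + (1 - t) *: c'); split.
  - exact: Uconv.
  - exact: Cconv.
  - rewrite !scalerDr !scalerN opprD.
    have {3}-> : c0 = t *: c0 + (1 - t) *: c0.
      by rewrite -scalerDl addrCA subrr addr0 scale1r.
    by rewrite addrACA; congr (_ + _); rewrite addrACA.
have Kabs x : exists2 t, 0 < t & K (t^-1 *: x).
  have [t t0 Ut] := nbhs0_scale_pos x U0; exists t^-1; rewrite ?invr_gt0//.
  by apply: UK; rewrite invrK.
have nK : ~ K (c0 - v).
  move=> [u [c [Uu Cc]]]; rewrite [RHS]addrC => /addrI e.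
  by apply: (UC _ Uu); rewrite /= -[u](subrK c) -e addrA subrr add0r.
have [f [fK fv]] := Hahn_Banach (c0 - v) (gauge_sublinear Kconv Kabs).
have fK1 x : K x -> f x <= 1.
  by move=> Kx; apply: le_trans (fK x) _; exact: gauge_le1.
have fv1 : 1 <= f (c0 - v) by rewrite fv; exact: gauge_ge1.
have fcont : continuous f.
  by apply: (linear_continuous_of_bound U0) => x Ux; apply: fK1; exact: UK.
have [t t0 Ut] := nbhs0_scale_pos (c0 - v) U0.
(* The strict inequality comes from the point t (c0 - v) of U, where f > 0. *)
exists (exist _ f fcont), (f v + f (t *: (c0 - v))) => /=; split.
  rewrite ltrDl linearZ /=.
  by rewrite (@mulr_gt0 R)// (lt_le_trans _ fv1).
move=> x Cx.
have : f (t *: (c0 - v) - x + c0) <= f (c0 - v).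
  apply: le_trans fv1; apply: fK1.
  by exists (t *: (c0 - v)), x.
rewrite linearD linearB /= linearB /=; lra.
Qed.

Lemma dual_weak_continuous (f : tvs_dual V) :
  continuous (sval f : weak_tvs V -> R).
Proof.
move=> x; have Fx : Filter (nbhs (x : weak_tvs V)) by exact: nbhs_filter.
have /cvg_sup/(_ f) xf := @cvg_id _ (nbhs (x : weak_tvs V)).
by move=> A fA; apply: (xf (sval f @^-1` A)); exact: (initial_continuous fA).
Qed.

Lemma weakly_closed_convex C : closed C -> is_convex C ->
  closed (C : set (weak_tvs V)).
Proof.
move=> Ccl Cconv v clv; apply: contrapT => nCv.
have C0 : C !=set0.
  by have [w [Cw _]] := clv setT (@filterT _ (nbhs (v : weak_tvs V)) _); exists w.
have [f [a [fv fC]]] := closed_convex_separation Ccl Cconv C0 nCv.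
have : nbhs (v : weak_tvs V) [set w | sval f w < a].
  exact: (@dual_weak_continuous f v [set y | y < a] (lt_nbhsl fv)).
by move=> /clv[w [/fC + /=]]; rewrite leNgt => /negP.
Qed.

(** The only form in which weak compactness is used: a weak cluster point of F
    belongs to every closed convex member of F. *)
Lemma weakly_precompact_cluster (F : set_system V) (A : set V) :
  ProperFilter F -> F A -> precompact (A : set (weak_tvs V)) ->
  exists v, forall C, closed C -> is_convex C -> F C -> C v.
Proof.
move=> FF FA; rewrite precompactE => cA.
have [|v [_ Fv]] := cA F FF.
  by apply: filterS FA; exact: (@subset_closure (weak_tvs V) A).
exists v => C Ccl Cconv FC.
apply: (weakly_closed_convex Ccl Cconv); move: Fv; rewrite clusterE; exact.
Qed.

End weakly_closed_convex.

(** * The inner product and the positive cone of L2 *)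

Section L2_inner_product.
Context d (T : measurableType d) (R : realType) (mu : {measure set T -> \bar R}).
Local Notation L2 := (LspaceType2 mu).
Implicit Types (u v w h : L2) (a t : R).

Lemma L2dot_integrable u v :
  mu.-integrable setT (EFin \o (fun x => L2fun u x * L2fun v x)).
Proof.
by apply/Lfun1_integrable; apply: Lfun2_mul_Lfun1; exact: L2fun_Lfun.
Qed.

Lemma L2fun_measurable u : measurable_fun setT (L2fun u).
Proof. by have /andP[+ _] := L2fun_Lfun u; rewrite inE. Qed.

Lemma L2dotC u v : L2dot u v = L2dot v u.
Proof. by apply: eq_Rintegral => x _; rewrite mulrC. Qed.

Lemma L2dot_linear a u v w :
  L2dot (a *: u + v) w = a * L2dot u w + L2dot v w.
Proof.
rewrite /L2dot -RintegralZl//; last exact: L2dot_integrable.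
rewrite -RintegralD//; last exact: L2dot_integrable; last first.
  exact: (integrableZl measurableT a (L2dot_integrable u w)).
congr fine; apply: ae_eq_integral => //.
- by apply/measurable_EFinP; apply: measurable_funM; exact: L2fun_measurable.
- apply/measurable_EFinP; apply: measurable_funD.
    apply: measurable_funM => //.
    by apply: measurable_funM; exact: L2fun_measurable.
  by apply: measurable_funM; exact: L2fun_measurable.
- apply: filterS2 (L2addE (a *: u) v) (L2scaleE a u) => x addE scaleE _ /=.
  by rewrite addE scaleE mulrDl mulrA.
Qed.

Lemma L2dotDl u v w : L2dot (u + v) w = L2dot u w + L2dot v w.
Proof. by have := L2dot_linear 1 u v w; rewrite scale1r mul1r. Qed.

Lemma L2dot0l w : L2dot 0 w = 0.
Proof. by have := L2dotDl 0 0 w; rewrite addr0; lra. Qed.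

Lemma L2dotZl a u w : L2dot (a *: u) w = a * L2dot u w.
Proof. by have := L2dot_linear a u 0 w; rewrite !addr0 L2dot0l addr0. Qed.

Lemma L2dotNl u w : L2dot (- u) w = - L2dot u w.
Proof. by rewrite -scaleN1r L2dotZl mulN1r. Qed.

Lemma L2dotBl u v w : L2dot (u - v) w = L2dot u w - L2dot v w.
Proof. by rewrite L2dotDl L2dotNl. Qed.

Lemma L2dotDr w u v : L2dot w (u + v) = L2dot w u + L2dot w v.
Proof. by rewrite L2dotC L2dotDl !(L2dotC w). Qed.

Lemma L2dotZr a w u : L2dot w (a *: u) = a * L2dot w u.
Proof. by rewrite L2dotC L2dotZl (L2dotC w). Qed.

Lemma L2dotNr w u : L2dot w (- u) = - L2dot w u.
Proof. by rewrite L2dotC L2dotNl (L2dotC w). Qed.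

Lemma L2dotBr w u v : L2dot w (u - v) = L2dot w u - L2dot w v.
Proof. by rewrite L2dotDr L2dotNr. Qed.

Lemma L2dotuu u : L2dot u u = `|u| ^+ 2.
Proof.
rewrite /L2dot /Rintegral -[in RHS](@powR_mulrn _ _ 2)//.
have -> : `|u| = L2norm u by [].
have fin : ('N[mu]_2%:E[EFin \o L2fun u])%E \is a fin_num.
  rewrite fin_numElt (lt_le_trans _ (Lnorm_ge0 _ _ _))//=.
  by have /andP[_] := L2fun_Lfun u; rewrite inE.
have -> : L2norm u `^ 2 = fine ('N[mu]_2%:E[EFin \o L2fun u] `^ 2)%E.
  by rewrite /L2norm; case: ('N[mu]_2%:E[_])%E fin.
congr fine; rewrite powR_Lnorm//; apply: eq_integral => x _ /=.
by rewrite powR_mulrn// real_normK ?num_real// expr2.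
Qed.

Lemma L2dotuu_ge0 u : 0 <= L2dot u u.
Proof. by rewrite L2dotuu sqr_ge0. Qed.

Lemma L2dotuu_eq0 u : L2dot u u = 0 -> u = 0.
Proof.
by rewrite L2dotuu => /eqP; rewrite sqrf_eq0 normr_eq0 => /eqP.
Qed.

Lemma L2normB_sqr u v :
  `|u - v| ^+ 2 = `|u| ^+ 2 - 2 * L2dot u v + `|v| ^+ 2.
Proof. rewrite -!L2dotuu !(L2dotBl, L2dotBr) (L2dotC v u); ring. Qed.

Lemma L2normD_sqr u v :
  `|u + v| ^+ 2 = `|u| ^+ 2 + 2 * L2dot u v + `|v| ^+ 2.
Proof. rewrite -!L2dotuu !(L2dotDl, L2dotDr) (L2dotC v u); ring. Qed.

Lemma L2dot_CS u v : `|L2dot u v| <= `|u| * `|v|.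
Proof.
have [->|u0] := eqVneq u 0; first by rewrite L2dot0l !normr0 mul0r.
have u20 : 0 < `|u| ^+ 2 by rewrite exprn_gt0// normr_gt0.
have := L2dotuu_ge0 (`|u| ^+ 2 *: v - L2dot u v *: u).
rewrite !(L2dotBl, L2dotBr, L2dotZl, L2dotZr) (L2dotC v u) !L2dotuu => h.
rewrite -ler_sqr ?nnegrE ?mulr_ge0// real_normK ?num_real// exprMn.
by rewrite -subr_ge0 -(pmulr_rge0 _ u20); nra.
Qed.

Lemma L2dot_le u v : L2dot u v <= `|u| * `|v|.
Proof. exact: le_trans (ler_norm _) (L2dot_CS u v). Qed.

Lemma L2dot_continuous h : continuous (fun u => L2dot u h : R^o).
Proof.
move=> u A /nbhs_ballP[e /= e0 eA].
have h0 : 0 < `|h| + 1 by rewrite ltr_wpDl.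
have eh : 0 < e / (`|h| + 1) by rewrite divr_gt0.
have := nbhsx_ballx u _ eh; rewrite -ball_normE.
apply: filterS => v /= uv.
apply: eA; rewrite /ball /= -L2dotBl (le_lt_trans (L2dot_CS _ _))//.
apply: (@le_lt_trans _ _ (`|u - v| * (`|h| + 1))).
  by rewrite ler_wpM2l// lerDl.
by rewrite -ltr_pdivlMr.
Qed.

End L2_inner_product.

Section positive_part.
Context d (T : measurableType d) (R : realType) (mu : {measure set T -> \bar R}).
Local Notation L2 := (LspaceType2 mu).
Implicit Types u v w : L2.

Definition L2neg u := L2pos u - u.

Lemma L2posE u : {ae mu, forall x, L2fun (L2pos u) x = Num.max (L2fun u x) 0}.
Proof. by apply: filterS (L2classE (L2pos_subproof u)) => x /(_ I) ->. Qed.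

Lemma L2negE u : {ae mu, forall x, L2fun (L2neg u) x = Num.max (- L2fun u x) 0}.
Proof.
apply: filterS3 (L2addE (L2pos u) (- u)) (L2oppE u) (L2posE u) => x -> -> ->.
by case: (leP (L2fun u x) 0); case: (leP (- L2fun u x) 0); lra.
Qed.

Lemma L2nonneg_pos u : L2nonneg (L2pos u).
Proof. by apply: filterS (L2posE u) => x ->; rewrite le_max lexx orbT. Qed.

Lemma L2nonneg_neg u : L2nonneg (L2neg u).
Proof. by apply: filterS (L2negE u) => x ->; rewrite le_max lexx orbT. Qed.

Lemma L2pos_id u : L2nonneg u -> L2pos u = u.
Proof.
move=> u0; apply: L2_aeP; apply: filterS2 (L2posE u) u0 => x -> ux0.
exact: max_l.
Qed.

Lemma L2dot_eq0_ae u v :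
  {ae mu, forall x, L2fun u x * L2fun v x = 0} -> L2dot u v = 0.
Proof.
move=> uv; rewrite /L2dot /Rintegral (ae_eq_integral (cst 0))//.
- by rewrite integral0.
- by apply/measurable_EFinP; apply: measurable_funM; exact: L2fun_measurable.
- by apply: filterS uv => x /= -> _.
Qed.

Lemma L2dot_ge0 u v : L2nonneg u -> L2nonneg v -> 0 <= L2dot u v.
Proof.
move=> u0 v0; rewrite -(L2pos_id u0) -(L2pos_id v0).
rewrite /L2dot /Rintegral.
rewrite (ae_eq_integral
  (fun x => (Num.max (L2fun u x) 0 * Num.max (L2fun v x) 0)%:E))//.
- by apply: fine_ge0; apply: integral_ge0 => x _;
  rewrite lee_fin mulr_ge0// le_max lexx orbT.
- by apply/measurable_EFinP; apply: measurable_funM; exact: L2fun_measurable.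
- apply/measurable_EFinP; apply: measurable_funM; apply: measurable_maxr => //;
  exact: L2fun_measurable.
- by apply: filterS2 (L2posE u) (L2posE v) => x /= -> -> _.
Qed.

Lemma L2dot_pos_neg u : L2dot (L2pos u) (L2neg u) = 0.
Proof.
apply: L2dot_eq0_ae; apply: filterS2 (L2posE u) (L2negE u) => x -> ->.
by case: (leP (L2fun u x) 0); case: (leP (- L2fun u x) 0); nra.
Qed.

End positive_part.

(** * Subgradients of convex functionals *)

Section subgradient_inequality.
Context d (T : measurableType d) (R : realType) (mu : {measure set T -> \bar R}).
Local Notation L2 := (LspaceType2 mu).
Context (V : lmodType R) (j : V -> L2) (phi : V -> \bar R).
Hypotheses (jD : forall a x y, j (a *: x + y) = a *: j x + j y)
  (phi_convex : convex_functional phi) (phiNy : forall v, phi v != -oo%E).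

Definition subgradient_at (uh : V) (f : L2) := effdom phi uh /\
  forall v, (phi uh + (L2dot f (j v - j uh))%:E <= phi v)%E.

Let jB x y : j (x - y) = j x - j y.
Proof. by rewrite addrC -scaleN1r jD scaleN1r addrC. Qed.

Lemma effdomP v : effdom phi v -> exists a, phi v = a%:E.
Proof.
by rewrite /effdom /=; have := phiNy v; case: (phi v) => // a; exists a.
Qed.

Lemma convex_segment (x y : V) (a b t : R) : phi x = a%:E -> phi y = b%:E ->
  0 <= t <= 1 -> (phi (x + t *: (y - x)) <= (a + t * (b - a))%:E)%E.
Proof.
move=> xa yb t01; have := phi_convex y x t01; rewrite xa yb.
have -> : t *: y + (1 - t) *: x = x + t *: (y - x).
  by rewrite scalerBl scale1r scalerBr addrCA addrA addrAC -addrA.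
by rewrite -!EFinM -EFinD; move/le_trans; apply; rewrite lee_fin; lra.
Qed.

(** For convex phi the difference quotients in the definition of the
    j-subgradient are nondecreasing in t: the condition on their lower limits at 0
    in all directions amounts to the same condition on their values at t = 1. *)
Lemma j_subgradP u f : j_subgrad j phi (u, f) <->
  exists2 uh, j uh = u & subgradient_at uh f.
Proof.
split => [[uh [uhdom /= juh fE]]|[uh juh [uhdom fE]]].
- exists uh => //; split => // v.
  have [vdom|] := pselect (effdom phi v); last first.
    by rewrite /effdom /= => /negP; rewrite -leNgt leye_eq => /eqP ->; rewrite leey.
  have [a uha] := effdomP uhdom; have [b vb] := effdomP vdom.
  have := fE (v - uh); rewrite jB juh uha vb -EFinD lee_fin limf_einfE.
  suff : (ereal_sup [set ereal_inf
      [set ((phi (uh + t *: (v - uh))%R - a%:E) * t^-1%:E)%E | t in A] | A in 0^'+]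
      <= (b - a)%:E)%E.
    by move=> /[swap] /le_trans /[apply]; rewrite lee_fin; lra.
  apply: ge_ereal_sup => _ [A A0 <-].
  have [t [At /andP[t0 t1]]] : exists t, A t /\ 0 < t <= 1.
    have : (\forall t \near (0 : R)^'+, A t /\ 0 < t <= 1).
      near=> t; split; first by near: t.
      apply/andP; split; first by [].
      by near: t; apply: nbhs_right_le.
    exact: filter_ex.
  apply: (@le_trans _ _ ((phi (uh + t *: (v - uh)) - a%:E) * t^-1%:E)%E).
    by apply: ereal_inf_lbound; exists t.
  rewrite lee_pdivrMr// leeBlDr// -EFinM -EFinD.
  have t01 : 0 <= t <= 1 by rewrite ltW.
  apply: le_trans (convex_segment uha vb t01) _.
  by rewrite lee_fin; lra.
- exists uh; split => // vh.
  have [a uha] := effdomP uhdom.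
  rewrite limf_einfE; apply: ereal_sup_ge.
  exists (ereal_inf [set ((phi (uh + t *: vh)%R - phi uh) * t^-1%:E)%E |
    t in [set t : R | 0 < t]]).
    by exists [set t : R | 0 < t] => //; exact: nbhs_right_gt.
  apply: le_ereal_inf_tmp => _ [t /= t0 <-].
  rewrite lee_pdivlMr// uha leeBrDr// addeC -uha -EFinM.
  have := fE (uh + t *: vh); rewrite [uh + t *: vh]addrC jD addrK.
  by rewrite L2dotZr mulrC.
Unshelve. all: by end_near. Qed.

(** The functional is compared at uh and uh + t (v - uh): convexity bounds phi
    there, the squared norm contributes its derivative up to O(t^2), and t
    tends to 0. *)
Lemma subgradient_of_minimizer (k : R) (x : L2) uh : 0 < k -> effdom phi uh ->
  (forall v, phi uh + (k * `|j uh - x| ^+ 2)%:E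
             <= phi v + (k * `|j v - x| ^+ 2)%:E)%E ->
  subgradient_at uh ((2 * k) *: (x - j uh)).
Proof.
move=> k0 uhdom umin; split=> // v.
have [vdom|] := pselect (effdom phi v); last first.
  by rewrite /effdom /= => /negP; rewrite -leNgt leye_eq => /eqP ->; rewrite leey.
have [a uha] := effdomP uhdom; have [b vb] := effdomP vdom.
rewrite uha vb -EFinD lee_fin L2dotZl.
set w := j v - j uh; set N := `|w| ^+ 2.
have N0 : 0 <= N by rewrite sqr_ge0.
have approx t : 0 < t -> t <= 1 ->
    a + 2 * k * L2dot (x - j uh) w <= b + t * (k * N).
  move=> t0 t1; have t01 : 0 <= t <= 1 by rewrite ltW.
  have := umin (uh + t *: (v - uh)).
  have -> : j (uh + t *: (v - uh)) - x = (j uh - x) + t *: w.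
    by rewrite [uh + _]addrC jD jB -addrA addrC.
  rewrite uha => /le_trans/(_ (leeD2r _ (convex_segment uha vb t01))).
  rewrite -!EFinD lee_fin (L2normD_sqr _ (t *: w)) L2dotZr normrZ exprMn.
  rewrite (gtr0_norm t0) -/N => h.
  have xw : L2dot (x - j uh) w = - L2dot (j uh - x) w.
    by rewrite -L2dotNl opprB.
  rewrite xw -(ler_pM2l t0); move: h; rewrite expr2; lra.
apply/ler_addgt0Pr => e e0.
have kN : 0 <= k * N by rewrite mulr_ge0// ltW.
have := approx (Num.min 1 (e / (k * N + 1))) _ _.
have kN1 : 0 < k * N + 1 by rewrite ltr_wpDl.
rewrite lt_min ltr01 divr_gt0// ge_min lexx => /(_ isT isT)/le_trans; apply.
rewrite lerD2l (@le_trans _ _ (e / (k * N + 1) * (k * N)))//.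
  by rewrite ler_wpM2r// ge_min lexx orbT.
by rewrite mulrAC ler_pdivrMr// ler_wpM2l ?lerDl// ltW.
Qed.

End subgradient_inequality.

(** * Minimizers for j-elliptic functionals *)

Section sublevels.
Context (R : realType) (V : tvsType R) (phi : V -> \bar R) (l : {linear V -> R^o}).
Hypotheses (phi_convex : convex_functional phi) (phiNy : forall v, phi v != -oo%E)
  (phi_lsc : lower_semicontinuous phi) (l_cont : continuous l).

Definition tilted_sublevel (a : R) : set V := [set v | (phi v + (l v : R)%:E <= a%:E)%E].

Lemma tilted_sublevel_convex a : is_convex (tilted_sublevel a).
Proof.
move=> x y t t01; rewrite /tilted_sublevel /=.
have lxy : l (t *: x + (1 - t) *: y) = t * l x + (1 - t) * l y.
  by rewrite linearP linearZ.
have := phi_convex x y t01; rewrite lxy.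
have := phiNy x; have := phiNy y.
case: (phi x) => [p| |] //; case: (phi y) => [q| |] // _ _.
rewrite -!EFinM -!EFinD !lee_fin => h hx hy.
apply: le_trans (leeD2r _ h) _; rewrite -EFinD lee_fin.
by move: t01 hx hy => /andP[t0 t1]; nra.
Qed.

Lemma tilted_sublevel_closed a : closed (tilted_sublevel a).
Proof.
move=> v clv; rewrite /tilted_sublevel /= leNgt; apply/negP => av.
have [b bphi bl] : exists2 b : R, (b%:E < phi v)%E & a - b < l v.
  move: av; have := phiNy v; case: (phi v) => [p| |] // _.
    rewrite -EFinD lte_fin => h; exists ((p + (a - l v)) / 2); last first.
      rewrite ltrBlDr -ltrBlDl ltr_pdivlMr//; lra.
    rewrite lte_fin ltr_pdivrMr//; lra.
  by move=> _; exists (a - l v + 1); [rewrite ltry|lra].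
have [A vA Aphi] := phi_lsc bphi.
have lv : nbhs v [set w | a - b < l w].
  exact: (l_cont (x := v) (lt_nbhsr bl)).
have [w [/= sw [Aw lw]]] := clv _ (filterI vA lv).
have := Aphi _ Aw; have := phiNy w; move: sw lw; rewrite /tilted_sublevel /=.
case: (phi w) => [p| |] //; rewrite -EFinD lee_fin lte_fin => pa ab _ bp.
by have := lt_le_trans (ltrD bp ab) pa; rewrite addrC subrK ltxx.
Qed.

End sublevels.

Lemma weak_id_continuous (R : realType) (V : tvsType R) :
  continuous (id : V -> weak_tvs V).
Proof.
move=> v; apply/cvg_sup => f A [B [[C Cop <-] Bv] BA].
apply: filterS BA _; apply: (svalP f).
exact: open_nbhs_nbhs.
Qed.

Section j_elliptic_functionals.
Context d (T : measurableType d) (R : realType) (mu : {measure set T -> \bar R}).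
Local Notation L2 := (LspaceType2 mu).
Context (V : tvsType R) (j : {linear V -> L2}) (phi : V -> \bar R).
Hypotheses (j_cont : weak_to_weak_continuous j).

Definition dot_left (h : L2) (u : L2) : R^o := L2dot u h.

Fact dot_left_linear h : linear (dot_left h).
Proof. by move=> a u v; exact: L2dot_linear. Qed.

HB.instance Definition _ h :=
  GRing.isLinear.Build R L2 R^o _ (dot_left h) (dot_left_linear h).

Definition j_dot (h : L2) : {linear V -> R^o} := dot_left h \o j.

Lemma j_dot_continuous h : continuous (j_dot h).
Proof.
pose f : tvs_dual L2 := exist _ (dot_left h : {linear L2 -> R^o}) (@L2dot_continuous _ _ _ _ h).
move=> v; apply: (@continuous_comp _ _ _ (id : V -> weak_tvs V)
  ((sval f : weak_tvs L2 -> R) \o (j : weak_tvs V -> weak_tvs L2)) v).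
  exact: weak_id_continuous.
apply: continuous_comp; first exact: j_cont.
exact: dual_weak_continuous.
Qed.

Hypotheses (phi_convex : convex_functional phi) (phi_proper : proper_functional phi)
  (phi_lsc : lower_semicontinuous phi).
Variable omega : R.
Hypotheses (omega0 : 0 <= omega)
  (phi_coercive : coercive (fun v => phi v + (omega / 2 * `|j v| ^+ 2)%:E)%E).

Let phiNy v : phi v != -oo%E. Proof. exact: phi_proper.1. Qed.

(** The test sets are the sublevels of phi + <j, h> and of <j, h>: they are
    convex, and closed because <j, h> is a continuous functional on V although j
    is only weakly continuous. *)
Lemma j_elliptic_cluster (F : set_system V) (C : R) : ProperFilter F ->
  F [set v | (phi v + (omega / 2 * `|j v| ^+ 2)%:E <= C%:E)%E] ->
  exists v, forall h a,
    (F [set w | (phi w + (L2dot (j w) h)%:E <= a%:E)%E] ->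
      (phi v + (L2dot (j v) h)%:E <= a%:E)%E) /\
    (F [set w | L2dot (j w) h <= a] -> L2dot (j v) h <= a).
Proof.
move=> FF FC; have [v Fv] := weakly_precompact_cluster FF FC (phi_coercive C).
exists v => h a; split=> Fa.
- have := Fv (tilted_sublevel phi (j_dot h) a); apply => //.
    by apply: tilted_sublevel_closed => //; exact: j_dot_continuous.
  exact: tilted_sublevel_convex.
- apply: (Fv [set w | L2dot (j w) h <= a]) => //.
    apply: (@closed_comp _ _ (j_dot h) [set x : R^o | x <= a]).
      by move=> x _; exact: j_dot_continuous.
    exact: closed_le.
  move=> x y t /andP[t0 t1] /= xa ya.
  by rewrite linearP linearZ /= L2dot_linear L2dotZl; nra.
Qed.

(** F is the filter of the sublevels of Phi = phi + k |j - x|^2 above its infimum.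
    They are weakly precompact because k > omega / 2.  The square is handled as
    the supremum over h of k (2 <j - x, h> - |h|^2), so that Phi is a supremum of
    functionals phi + <j, h> + constant, each of which passes to the cluster
    point. *)
Lemma minimizer_exists (k : R) (x : L2) : omega / 2 < k ->
  exists2 uh, effdom phi uh & forall v, (phi uh + (k * `|j uh - x| ^+ 2)%:E
    <= phi v + (k * `|j v - x| ^+ 2)%:E)%E.
Proof.
move=> ok; have k0 : 0 < k by apply: le_lt_trans ok; rewrite divr_ge0.
pose Phi v := (phi v + (k * `|j v - x| ^+ 2)%:E)%E.
pose I := [set c : R | exists w, (Phi w < c%:E)%E].
have [v0 v0dom] := phi_proper.2.
have [a0 v0a0] := effdomP phiNy v0dom.
have I0 : I !=set0.
  exists (a0 + k * `|j v0 - x| ^+ 2 + 1), v0.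
  by rewrite /Phi v0a0 -EFinD lte_fin ltrDl.
pose F := filter_from I (fun c => [set v | (Phi v < c%:E)%E]).
have FF : ProperFilter F.
  apply: filter_from_proper; last by move=> c [w wc]; exists w.
  apply: filter_from_filter => // c c' Ic Ic'; exists (Num.min c c').
    by rewrite /I /=; case: (leP c c').
  by move=> v /= vc; split; apply: (lt_le_trans vc);
    rewrite lee_fin ge_min lexx ?orbT.
have FI c : I c -> F [set v | (Phi v < c%:E)%E] by move=> Ic; exists c.
have [c0 Ic0] := I0.
have del : 0 < k - omega / 2 by rewrite subr_gt0.
pose C := c0 + (k * `|x|) ^+ 2 / (k - omega / 2).
have FC : F [set v | (phi v + (omega / 2 * `|j v| ^+ 2)%:E <= C%:E)%E].
  apply: filterS (FI _ Ic0) => v /=; rewrite /Phi; have := phiNy v.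
  case: (phi v) => [p| |]//= _; rewrite -!EFinD lte_fin lee_fin => pc.
  have := L2dot_le (j v) x; have := normr_ge0 (j v); have := normr_ge0 x.
  move: pc; rewrite L2normB_sqr /C.
  set r := `|j v|; set s := `|x|; set D := L2dot _ _ => pc s0 r0 Ds.
  set e := k - omega / 2 in del *.
  have eE : omega / 2 = k - e by rewrite /e opprB addrC subrK.
  (* Complete the square in e r^2 - 2 k s r, with e = k - omega / 2. *)
  rewrite eE -lerBlDl ler_pdivlMr//.
  have : 0 <= (e * r - k * s) ^+ 2 by rewrite sqr_ge0.
  have : k * D * e <= k * (r * s) * e by rewrite ler_pM2r// ler_pM2l.
  have : (p + k * (r ^+ 2 - 2 * D + s ^+ 2)) * e <= c0 * e.
    by rewrite ler_pM2r// ltW.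
  have : 0 <= k * s ^+ 2 * e by rewrite !mulr_ge0// ltW.
  rewrite !expr2; lra.
have [v vP] := j_elliptic_cluster FF FC.
have vI c : I c -> (Phi v <= c%:E)%E.
  move=> Ic; pose h := j v - x.
  have sq w : k * (2 * L2dot (j w) h - 2 * L2dot x h - `|h| ^+ 2)
      <= k * `|j w - x| ^+ 2.
    rewrite ler_pM2l//; have := sqr_ge0 `|(j w - x) - h|.
    rewrite L2normB_sqr L2dotBl; lra.
  have [Fv _] := vP ((2 * k) *: h) (c + k * (2 * L2dot x h + `|h| ^+ 2)).
  have {Fv} : (phi v + (L2dot (j v) ((2 * k) *: h))%:E <=
      (c + k * (2 * L2dot x h + `|h| ^+ 2))%:E)%E.
    apply: Fv; apply: filterS (FI _ Ic) => w /=; rewrite /Phi L2dotZr.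
    have := phiNy w; case: (phi w) => [p| |]//= _.
    by rewrite -!EFinD lte_fin lee_fin; have := sq w; lra.
  rewrite /Phi L2dotZr; have := phiNy v; case: (phi v) => [p| |]//= _.
  rewrite -!EFinD !lee_fin -/h.
  have : L2dot (j v) h - L2dot x h = `|h| ^+ 2 by rewrite -L2dotBl L2dotuu.
  by move=> <-; lra.
exists v.
  have := vI _ Ic0; rewrite /Phi /effdom /=.
  by have := phiNy v; case: (phi v) => [p| |]//= _ _; exact: ltry.
move=> w; apply/lee_addgt0Pr => e e0.
have := phiNy w; case phiw : (phi w) => [p| |]//= _; last by rewrite leey.
rewrite -!EFinD; apply: vI; exists w.
by rewrite /Phi phiw -EFinD lte_fin ltrDl.
Qed.

End j_elliptic_functionals.

(** * Comparison of phiH with phi *)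

(** On a partition of [a, b] into n equal intervals the quadratic errors add up to
    at most |K| (b - a)^2 / n. *)
Lemma quadratic_increment_le (R : realType) (Q : R -> R) (a b e K : R) : a <= b ->
  (forall s t, a <= s -> s <= t -> t <= b ->
    Q t - Q s <= - e * (t - s) + K * (t - s) ^+ 2) ->
  Q b - Q a <= - e * (b - a).
Proof.
move=> ab QK; apply/ler_addgt0Pr => eps eps0.
pose x := `|K| * (b - a) ^+ 2 / eps.
have x0 : 0 <= x.
  by apply: divr_ge0 (ltW eps0); rewrite mulr_ge0// sqr_ge0.
pose n := Num.bound x; have xn : x < n%:R by exact: archi_boundP.
have n0 : (0 : R) < n%:R by exact: le_lt_trans xn.
pose h := (b - a) / n%:R.
have h0 : 0 <= h by rewrite /h divr_ge0// subr_ge0.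
have nh : n%:R * h = b - a by rewrite /h mulrC divfK// gt_eqF.
have step i : (i <= n)%N ->
    Q (a + i%:R * h) - Q a <= i%:R * (- e * h + K * h ^+ 2).
  elim: i => [|i IH] lein; first by rewrite !mul0r addr0 subrr.
  have := IH (ltnW lein).
  have := QK (a + i%:R * h) (a + i.+1%:R * h).
  have -> : a + i.+1%:R * h - (a + i%:R * h) = h by rewrite -natr1; ring.
  have -> : (a <= a + i%:R * h) = true by rewrite lerDl mulr_ge0.
  have -> : (a + i%:R * h <= a + i.+1%:R * h) = true.
    by rewrite lerD2l ler_wpM2r// ler_nat.
  have -> : (a + i.+1%:R * h <= b) = true.
    by rewrite -lerBrDl -nh ler_wpM2r// ler_nat.
  by move=> /(_ isT isT isT); rewrite -natr1; lra.
have := step n (leqnn _); rewrite nh (addrC a) subrK => /le_trans; apply.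
have -> : n%:R * (- e * h + K * h ^+ 2) = - e * (b - a) + K * (b - a) * h.
  by rewrite -nh; ring.
rewrite lerD2l (@le_trans _ _ (`|K| * (b - a) * h))//.
  by rewrite ler_wpM2r// ler_wpM2r ?subr_ge0// ler_norm.
rewrite /h mulrA ler_pdivrMr// -mulrA -expr2 -ler_pdivrMl//.
by rewrite mulrC ltW.
Qed.

Section identification.
Context d (T : measurableType d) (R : realType) (mu : {measure set T -> \bar R}).
Local Notation L2 := (LspaceType2 mu).
Context (V : tvsType R) (j : {linear V -> L2}) (phi : V -> \bar R)
  (phiH : L2 -> \bar R).
Hypotheses (j_cont : weak_to_weak_continuous j)
  (phi_convex : convex_functional phi) (phi_proper : proper_functional phi)
  (phi_lsc : lower_semicontinuous phi) (phiHP : is_phiH j phi phiH).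
Variable omega : R.
Hypotheses (omega0 : 0 <= omega)
  (phi_coercive : coercive (fun v => phi v + (omega / 2 * `|j v| ^+ 2)%:E)%E).
Implicit Types (uh vh : V) (u f g x y z : L2) (k : R).

Let phiNy v : phi v != -oo%E. Proof. exact: phi_proper.1. Qed.
Let phiHNy u : phiH u != -oo%E. Proof. by case: phiHP => _ [+ _] _ _; exact. Qed.

Lemma subgradient_phiH uh f :
  subgradient_at j phi uh f -> subgradient_at id phiH (j uh) f.
Proof.
move=> sub; have [Hconv _ _ Hsub] := phiHP.
have [v <- //] := (j_subgradP (j := id) (fun _ _ _ => erefl) Hconv phiHNy _ _).1
  (Hsub _ ((j_subgradP (linearP j) phi_convex phiNy _ _).2
    (ex_intro2 _ _ uh erefl sub))).
Qed.

Lemma subgradient_phiH_le uh f v : subgradient_at j phi uh f ->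
  (phiH (j uh) + (L2dot f (v - j uh))%:E <= phiH v)%E.
Proof. by case/subgradient_phiH => _; apply. Qed.

(** The constant by which phiH exceeds the infimum of phi on the fibre of j, read
    at a point where both values are finite. *)
Definition gap uh := fine (phiH (j uh)) - fine (phi uh).

(** The subgradient inequality of phiH is used at vh, that of phi at uh. *)
Lemma gap_increment uh f vh g :
  subgradient_at j phi uh f -> subgradient_at j phi vh g ->
  gap vh - gap uh <= L2dot (g - f) (j vh - j uh).
Proof.
move=> sf sg; have [uH _] := subgradient_phiH sf.
have [vH Hv] := subgradient_phiH sg; have := Hv (j uh).
have [ud fu] := sf; have [vd _] := sg; have := fu vh.
have [p up] := effdomP phiNy ud; have [q vq] := effdomP phiNy vd.
have [p' up'] := effdomP phiHNy uH; have [q' vq'] := effdomP phiHNy vH.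
rewrite /gap up vq up' vq' -!EFinD !lee_fin /= L2dotBl.
rewrite -[j uh - j vh]opprB L2dotNr; lra.
Qed.

(** With x = j vh - j uh and y = z' - z the bound of [gap_increment] is
    2k <y - x, x>, which is at most k |y|^2 / 2 because |y - 2 x|^2 >= 0. *)
Lemma gap_increment_sqr k z z' uh vh : 0 < k ->
  subgradient_at j phi uh ((2 * k) *: (z - j uh)) ->
  subgradient_at j phi vh ((2 * k) *: (z' - j vh)) ->
  gap vh - gap uh <= k / 2 * `|z' - z| ^+ 2.
Proof.
move=> k0 su sv; apply: le_trans (gap_increment su sv) _.
set b := j vh - j uh.
have -> : (2 * k) *: (z' - j vh) - (2 * k) *: (z - j uh) =
    (2 * k) *: ((z' - z) - b).
  rewrite -scalerBr /b; congr (_ *: _).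
  by rewrite !opprD !opprK addrACA.
rewrite L2dotZl L2dotBl L2dotuu.
have := sqr_ge0 `|(z' - z) - 2 *: b|.
rewrite (L2normB_sqr (z' - z)) L2dotZr normrZ exprMn (ger0_norm (ler0n _ 2)).
nra.
Qed.

Variable k0 : R.
Hypothesis omegak0 : omega / 2 < k0.

Let k_gt0 k : k0 <= k -> 0 < k.
Proof. by move=> kk; apply: lt_le_trans kk; apply: le_lt_trans omegak0; rewrite divr_ge0. Qed.

Lemma resolvent_exists k x : k0 <= k -> exists uh,
  subgradient_at j phi uh ((2 * k) *: (x - j uh)) /\
  forall v, (phi uh + (k * `|j uh - x| ^+ 2)%:E
    <= phi v + (k * `|j v - x| ^+ 2)%:E)%E.
Proof.
move=> kk; have [uh ud umin] := minimizer_exists j_cont phi_convex phi_proper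
  phi_lsc omega0 phi_coercive x (lt_le_trans omegak0 kk).
exists uh; split => //.
exact: (subgradient_of_minimizer (linearP j) phi_convex phiNy (k_gt0 kk)).
Qed.

(** Minimizers for the points of the segment from x = j uh + f / (2 k0) to
    y = j vh + g / (2 k0) join the two given points, and the gap has quadratic
    increments along the segment, in both directions. *)
Lemma gap_constant uh f vh g :
  subgradient_at j phi uh f -> subgradient_at j phi vh g -> gap uh = gap vh.
Proof.
move=> su sv; have k00 : 0 < k0 by exact: k_gt0.
have k20 : 2 * k0 != 0 by rewrite gt_eqF// mulr_gt0.
pose x := j uh + (2 * k0)^-1 *: f; pose y := j vh + (2 * k0)^-1 *: g.
have fx : f = (2 * k0) *: (x - j uh).
  by rewrite /x addrAC subrr add0r scalerA divff// scale1r.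
have gy : g = (2 * k0) *: (y - j vh).
  by rewrite /y addrAC subrr add0r scalerA divff// scale1r.
pose z t := x + t *: (y - x).
have [w ws] := choice (fun t => resolvent_exists (z t) (lexx k0)).
have wz s t : gap (w t) - gap (w s) <= k0 / 2 * `|y - x| ^+ 2 * (t - s) ^+ 2.
  have := gap_increment_sqr k00 (ws s).1 (ws t).1.
  have -> : z t - z s = (t - s) *: (y - x).
    by rewrite /z scalerBl (opprD x) addrACA subrr add0r.
  by rewrite normrZ exprMn real_normK ?num_real// => /le_trans; apply; lra.
have w01 : gap (w 1) - gap (w 0) <= - 0 * (1 - 0).
  apply: (@quadratic_increment_le _ (gap \o w) 0 1 0) => // s t _ _ _ /=.
  rewrite oppr0 mul0r add0r; exact: wz.
have w10 : - gap (w 1) - - gap (w 0) <= - 0 * (1 - 0).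
  apply: (@quadratic_increment_le _ (fun t => - gap (w t)) 0 1 0
    (k0 / 2 * `|y - x| ^+ 2)) => // s t _ _ _ /=.
  by have := wz t s; rewrite -[s - t]opprB sqrrN; lra.
have same z' uh' vh' : subgradient_at j phi uh' ((2 * k0) *: (z' - j uh')) ->
    subgradient_at j phi vh' ((2 * k0) *: (z' - j vh')) -> gap vh' <= gap uh'.
  move=> su' sv'; have := gap_increment_sqr k00 su' sv'.
  by rewrite subrr normr0 expr0n mulr0 subr_le0.
have z0 : z 0 = x by rewrite /z scale0r addr0.
have z1 : z 1 = y by rewrite /z scale1r addrC subrK.
rewrite fx in su; rewrite gy in sv.
have s0 := (ws 0).1; have s1 := (ws 1).1; rewrite z0 in s0; rewrite z1 in s1.
have := same _ _ _ su s0; have := same _ _ _ s0 su.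
have := same _ _ _ sv s1; have := same _ _ _ s1 sv.
by move=> *; apply/eqP; rewrite eq_le; apply/andP; split; lra.
Qed.

(** A subgradient f of phi at some point bounds phi below by an affine function of
    j, so that k r^2 <= N + |f| r for r = |j uh - u|, where N depends on u and M
    only. *)
Lemma resolvent_close u (M del : R) : 0 < del -> exists k1, forall k uh, k1 <= k ->
  (phi uh + (k * `|j uh - u| ^+ 2)%:E <= M%:E)%E -> `|j uh - u| < del.
Proof.
move=> del0; have [us [[usd us_sub] _]] := resolvent_exists u (lexx k0).
set f := _ *: _ in us_sub; have [a usa] := effdomP phiNy usd.
pose N := M - a + `|f| * `|u - j us|.
(* With this bound, r >= del would give r (k r - |f|) >= |N| + 1 > N. *)
exists (((`|N| + 1) / del + `|f|) / del) => k uh kk uM.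
rewrite ltNge; apply/negP => delr.
have := us_sub uh; move: uM; have := phiNy uh; rewrite usa.
case: (phi uh) => [p| |]//= _; rewrite -!EFinD !lee_fin.
set r := `|j uh - u| in delr *; move=> pM ap.
have : - (`|f| * (r + `|u - j us|)) <= L2dot f (j uh - j us).
  apply: (@le_trans _ _ (- (`|f| * `|j uh - j us|))).
    rewrite lerN2 ler_wpM2l//.
    by rewrite -[j uh - j us](subrKA u) ler_normD.
  by have := L2dot_le (- f) (j uh - j us); rewrite L2dotNl normrN; lra.
have k0' : 0 <= k.
  apply: le_trans kk; apply: divr_ge0 (ltW del0); apply: addr_ge0 => //.
  by apply: divr_ge0 (ltW del0); apply: addr_ge0.
have : (`|N| + 1) / del <= k * r - `|f|.
  rewrite lerBrDr; move: kk; rewrite ler_pdivrMr// => /le_trans; apply.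
  by rewrite ler_wpM2l.
rewrite ler_pdivrMr// => h1 h2.
have r0 : 0 <= r := le_trans (ltW del0) delr.
have : `|N| + 1 <= (k * r - `|f|) * r.
  apply: (le_trans h1); rewrite ler_wpM2l//.
  have := le_trans (_ : 0 <= `|N| + 1) h1.
  by rewrite pmulr_lge0//; apply; rewrite addr_ge0.
by have := ler_norm N; rewrite /N expr2 in pM *; lra.
Qed.

(** Both halves use the minimizers w k of phi + k |j - u|^2 as k tends to infinity,
    where phiH (j (w k)) = phi (w k) + c.  For the first, phi (w k) <= phi uh and
    phiH is lower semicontinuous at u = j uh.  For the second, the subgradient
    inequality of phiH at j (w k) gives phi (w k) <= phiH u - c, and a weak
    cluster point of the w k lies in the fibre of u with the same bound. *)
Lemma phiH_is_infimum : exists c : R,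
  (forall uh p, phi uh = p%:E -> (phiH (j uh) <= (p + c)%:E)%E) /\
  (forall u q, phiH u = q%:E ->
    exists2 uh, j uh = u & (phi uh <= (q - c)%:E)%E).
Proof.
have [us [us_sub _]] := resolvent_exists 0 (lexx k0).
pose c := gap us.
have phiHc uh f : subgradient_at j phi uh f -> phiH (j uh) = (phi uh + c%:E)%E.
  move=> s; rewrite /c (gap_constant us_sub s) /gap.
  have [ud _] := s; have [uH _] := subgradient_phiH s.
  have [p ->] := effdomP phiNy ud; have [p' ->] := effdomP phiHNy uH.
  by rewrite -EFinD /= addrC subrK.
exists c; split => [uh p uhp|u q uq].
- rewrite leNgt; apply/negP => pH; have [_ _ Hlsc _] := phiHP.
  have [A uA Aphi] := Hlsc _ _ pH.
  have [del /= del0 delA] := (nbhs_ballP _ _).1 uA.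
  have [k1 k1P] := resolvent_close (j uh) p del0.
  have kk : k0 <= Num.max k0 k1 by rewrite le_max lexx.
  have [w [ws wmin]] := resolvent_exists (j uh) kk.
  have := wmin uh; rewrite uhp subrr normr0 expr0n mulr0 adde0 => wp.
  have /k1P/(_ wp) wclose : k1 <= Num.max k0 k1 by rewrite le_max lexx orbT.
  have := Aphi (j w); rewrite (phiHc _ _ ws).
  have wA : A (j w).
    by apply: delA; rewrite -ball_normE /= -normrN opprB.
  move=> /(_ wA); move: wp; have := phiNy w; case: (phi w) => [r| |]//= _.
  rewrite -!EFinD lee_fin lte_fin ltrD2r => rp.
  rewrite ltNge (le_trans _ rp)// lerDl.
  by apply: mulr_ge0; [rewrite ltW// k_gt0|exact: sqr_ge0].
- pose M := q - c.
  have Hk k : exists uh, k0 <= k ->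
      (phi uh + (k * `|j uh - u| ^+ 2)%:E <= M%:E)%E.
    have [kk|kk] := leP k0 k; last by exists us.
    have [w [ws _]] := resolvent_exists u kk; exists w => _.
    have := subgradient_phiH_le u ws; rewrite uq (phiHc _ _ ws).
    have [wd _] := ws; have [a ->] := effdomP phiNy wd.
    rewrite L2dotZl L2dotuu -normrN opprB -!EFinD !lee_fin /M.
    have := k_gt0 kk; have := sqr_ge0 `|j w - u|; nra.
  have [w wP] := choice Hk.
  pose F := w @ (pinfty_nbhs R).
  have FF : ProperFilter F by exact: fmap_proper_filter.
  have wM : \forall k \near +oo, (phi (w k) <= M%:E)%E.
    near=> k; have kk : k0 <= k by near: k; exact: (nbhs_pinfty_ge (num_real _)).
    apply: le_trans (wP k kk); apply: leeDl; rewrite lee_fin.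
    by apply: mulr_ge0; [rewrite ltW// k_gt0|exact: sqr_ge0].
  have wu (del : R) : 0 < del -> \forall k \near +oo, `|j (w k) - u| < del.
    move=> del0; have [k1 k1P] := resolvent_close u M del0.
    near=> k; apply: (k1P k); first by near: k; exact: (nbhs_pinfty_ge (num_real _)).
    by apply: wP; near: k; exact: (nbhs_pinfty_ge (num_real _)).
  pose C := M + omega / 2 * (`|u| + 1) ^+ 2.
  have FC : F [set v | (phi v + (omega / 2 * `|j v| ^+ 2)%:E <= C%:E)%E].
    have w1 := wu 1 ltr01.
    rewrite /F /=; near=> k => /=.
    rewrite /C EFinD; apply: leeD; first by near: k.
    rewrite lee_fin ler_wpM2l ?divr_ge0// ler_sqr ?nnegrE// ?addr_ge0//.
    rewrite -[j _](subrK u) (le_trans (ler_normD _ _))// addrC lerD2l ltW//.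
    by near: k.
  have [v vP] := j_elliptic_cluster j_cont phi_convex phi_proper phi_lsc
    phi_coercive FF FC.
  exists v; last first.
    have [+ _] := vP 0 M; rewrite L2dotC L2dot0l adde0; apply.
    apply: filterS wM => k /=.
    by rewrite L2dotC L2dot0l adde0.
  apply/eqP; rewrite -subr_eq0; apply/eqP/L2dotuu_eq0/eqP.
  rewrite eq_le L2dotuu_ge0 andbT; apply/ler_addgt0Pr => e e0; rewrite add0r.
  set h := j v - u; rewrite L2dotBl lerBlDl.
  have [_ vh] := vP h (L2dot u h + e); apply: vh.
  have eh : 0 < e / (`|h| + 1) by rewrite divr_gt0// ltr_wpDl.
  apply: filterS (wu _ eh) => k /= /ltW wk.
  rewrite -lerBlDl -L2dotBl (le_trans (L2dot_le _ _))//.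
  rewrite (@le_trans _ _ (`|j (w k) - u| * (`|h| + 1)))//.
    by rewrite ler_wpM2l// lerDl.
  by rewrite -ler_pdivlMr// ltr_wpDl.
Unshelve. all: by end_near. Qed.

End identification.

(** * Weak derivatives *)

Section null_modification.
Import HBNNSimple.
Context d (T : measurableType d) (R : realType) (mu : {measure set T -> \bar R}).
Variables (N : set T) (mN : measurable N) (N0 : mu N = 0%E).
Implicit Types f g : T -> \bar R.
Local Open Scope ereal_scope.

Let ge0_le_integral_null f g : (forall x, 0 <= f x) -> (forall x, 0 <= g x) ->
  (forall x, ~ N x -> f x = g x) -> \int[mu]_x f x <= \int[mu]_x g x.
Proof.
move=> f0 g0 fg; rewrite !ge0_integralTE//; apply: ge_ereal_sup => _ [h /= hf <-].
pose h' := proj_nnsfun h (measurableC mN).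
have -> : sintegral mu h = sintegral mu h'.
  rewrite -!integralT_nnsfun; apply: ge0_ae_eq_integral => //.
  - by apply/measurable_EFinP.
  - by apply/measurable_EFinP.
  - by move=> x _; rewrite lee_fin.
  - by move=> x _; rewrite lee_fin.
  - exists N; split => // x /= /not_implyP[_ hx]; apply: contrapT => nN.
    by apply: hx; rewrite /h' /= mindicE mem_set//= mulr1.
apply: ereal_sup_ubound; exists h' => //= x.
rewrite mindicE; have [xN|xN] := boolP (x \in ~` N).
  by rewrite mulr1 -fg//; exact: set_mem.
by rewrite mulr0.
Qed.

(** A simple function below f^+ can be set to 0 on N without changing its
    integral; this covers functions that are not measurable, such as <g, h> in
    the weak derivative identity, which is only almost everywhere a limit of
    measurable functions. *)
Lemma integral_null_modification f g : (forall x, ~ N x -> f x = g x) ->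
  \int[mu]_x f x = \int[mu]_x g x.
Proof.
move=> fg; rewrite integralE [RHS]integralE.
have eq_nn f' g' : (forall x, 0 <= f' x) -> (forall x, 0 <= g' x) ->
    (forall x, ~ N x -> f' x = g' x) -> \int[mu]_x f' x = \int[mu]_x g' x.
  move=> f0 g0 fg'; apply/eqP; rewrite eq_le.
  by apply/andP; split; apply: ge0_le_integral_null => // x xN; rewrite fg'.
by congr (_ - _); apply: eq_nn => // x /fg; rewrite /= ?(funeposE, funenegE) => ->.
Qed.

End null_modification.

Section quadratic_spline.
Context (R : realType).
Implicit Types (s t x : R).

Definition pospart_sqr x : R := Num.max x 0 ^+ 2.

(** The error of the first-order expansion is at most h^2, which avoids a
    discussion at 0. *)
Lemma is_derive_pospart_sqr x :
  is_derive x (1 : R) pospart_sqr (2 * Num.max x 0).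
Proof.
have key (h : R) : `|pospart_sqr (x + h) - pospart_sqr x - 2 * Num.max x 0 * h| <= h ^+ 2.
  rewrite /pospart_sqr ler_norml; apply/andP; split;
  by case: (leP x 0); case: (leP (x + h) 0); nra.
have cv : (fun h => h^-1 *: ((pospart_sqr \o shift x) (h *: (1 : R)) - pospart_sqr x)) @ 0^'
    --> (2 * Num.max x 0 : R).
  apply/cvgrPdist_le => e e0; near=> h.
  have h0 : h != 0 by near: h; exact: nbhs_dnbhs_neq.
  have he : `|h| <= e.
    near: h; apply: dnbhs0_le; exact: e0.
  apply: le_trans he; rewrite -(ler_pM2r (_ : 0 < `|h|)) ?normr_gt0//.
  rewrite -normrM -expr2 real_normK ?num_real//; apply: le_trans (key h).
  rewrite -normrN /= /GRing.scale /= mulr1 [h + x]addrC.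
  rewrite le_eqVlt; apply/orP; left; apply/eqP; congr `|_|.
  by field.
apply: DeriveDef; first exact: cvgP cv.
exact: cvg_lim cv.
Unshelve. all: by end_near. Qed.

(** The C^1 quadratic spline which rises from 0 to 1 on [0, 2]; its derivative is
    the hat function. *)
Definition smooth_step x : R :=
  (pospart_sqr x - 2 * pospart_sqr (x - 1) + pospart_sqr (x - 2)) / 2.

Definition hat x : R := Num.max x 0 - 2 * Num.max (x - 1) 0 + Num.max (x - 2) 0.

Lemma smooth_step_le0 x : x <= 0 -> smooth_step x = 0.
Proof.
move=> x0; rewrite /smooth_step /pospart_sqr !max_r; lra.
Qed.

Lemma smooth_step_ge2 x : 2 <= x -> smooth_step x = 1.
Proof.
move=> x2; rewrite /smooth_step /pospart_sqr !max_l; lra.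
Qed.

Lemma smooth_step_itv x : 0 <= smooth_step x <= 1.
Proof.
rewrite /smooth_step /pospart_sqr.
by case: (leP x 0); case: (leP (x - 1) 0); case: (leP (x - 2) 0); nra.
Qed.

Lemma hat_ge0 x : 0 <= hat x.
Proof.
by rewrite /hat; case: (leP x 0); case: (leP (x - 1) 0); case: (leP (x - 2) 0); lra.
Qed.

Lemma hat_eq0 x : ~~ (0 < x < 2) -> hat x = 0.
Proof.
rewrite /hat negb_and -!leNgt => /orP[x0|x2].
  by rewrite !max_r; lra.
by rewrite !max_l; lra.
Qed.

End quadratic_spline.

Section trapezoid.
Context (R : realType).
Implicit Types (s t x c : R) (f : R -> R).

Lemma is_derive_affine_comp f (df : R) c e x :
  is_derive (c * x + e) (1 : R) f df ->
  is_derive x (1 : R) (fun t => f (c * t + e)) (c * df).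
Proof.
move=> fdf.
have aff : is_derive x (1 : R) (fun t : R => c * t + e : R) c.
  apply: is_derive_eq; rewrite /GRing.scale /=; ring.
rewrite mulrC; exact: (@is_derive1_comp _ f (fun t => c * t + e)).
Qed.

Lemma is_derive_smooth_step x : is_derive x (1 : R) (@smooth_step R) (hat x).
Proof.
have d0 := is_derive_pospart_sqr x.
have d c : is_derive x (1 : R) (fun t => pospart_sqr (t - c)) (2 * Num.max (x - c) 0).
  have := @is_derive_affine_comp (@pospart_sqr R) (2 * Num.max (x - c) 0) 1 (- c) x.
  rewrite mul1r mul1r => /(_ (is_derive_pospart_sqr _)).
  by under eq_fun do rewrite mul1r.
have d1 := d 1; have d2 := d 2.
have -> : @smooth_step R = (fun t => (pospart_sqr t - 2 * pospart_sqr (t - 1)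
  + pospart_sqr (t - 2)) * 2^-1) by [].
by apply: is_derive_eq; rewrite /GRing.scale /= /hat; field.
Qed.

Variables (a b del : R).
Hypotheses (del0 : 0 < del) (abdel : 4 * del <= b - a).

(** Zero outside [a, b], one on [a + 2 del, b - 2 del], smooth steps of length
    2 del in between. *)
Definition trapezoid t := smooth_step (del^-1 * t + - (del^-1 * a))
  - smooth_step (del^-1 * t + (2 - del^-1 * b)).

Definition trapezoid_slope t := del^-1 * hat (del^-1 * t + - (del^-1 * a))
  - del^-1 * hat (del^-1 * t + (2 - del^-1 * b)).

Lemma is_derive_trapezoid t : is_derive t (1 : R) trapezoid (trapezoid_slope t).
Proof.
have da := @is_derive_affine_comp (@smooth_step R) _ del^-1 (- (del^-1 * a)) t
  (is_derive_smooth_step _).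
have db := @is_derive_affine_comp (@smooth_step R) _ del^-1 (2 - del^-1 * b) t
  (is_derive_smooth_step _).
exact: is_deriveB.
Qed.

Lemma derive1_trapezoid : derive1 trapezoid = trapezoid_slope.
Proof.
apply/funext => t; rewrite derive1E; have := is_derive_trapezoid t.
by move=> ?; rewrite derive_val.
Qed.

Lemma continuous_hat : continuous (@hat R).
Proof.
have cmax c : continuous (fun t : R => Num.max (t - c) 0).
  move=> t; apply: (@continuous_max _ _ (fun t : R => t - c) (cst 0)).
    by apply: cvgB; [exact: cvg_id|exact: cvg_cst].
  exact: cvg_cst.
have -> : @hat R = (fun t => Num.max (t - 0) 0 - 2 * Num.max (t - 1) 0
    + Num.max (t - 2) 0) by apply/funext => t; rewrite subr0.
move=> t; apply: cvgD; last exact: cmax.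
by apply: cvgB; [exact: cmax|apply: cvgM; [exact: cvg_cst|exact: cmax]].
Qed.

Lemma continuous_trapezoid_slope : continuous trapezoid_slope.
Proof.
have caff c e : continuous (fun t : R => c * t + e).
  move=> t; apply: cvgD; last exact: cvg_cst.
  by apply: cvgM; [exact: cvg_cst|exact: cvg_id].
have chat c e : continuous (fun t : R => hat (c * t + e)).
  move=> t; apply: (@continuous_comp _ _ _ (fun t : R => c * t + e) (@hat R) t).
    exact: caff.
  exact: continuous_hat.
by move=> t; apply: cvgB; (apply: cvgM; [exact: cvg_cst|exact: chat]).
Qed.

Let le_scale t c x : c + x * del <= t -> x <= del^-1 * t + - (del^-1 * c).
Proof. by rewrite -mulrBr [del^-1 * _]mulrC ler_pdivlMr// => h; rewrite lerBrDl. Qed.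

Let ge_scale t c x : t <= c + x * del -> del^-1 * t + - (del^-1 * c) <= x.
Proof. by rewrite -mulrBr [del^-1 * _]mulrC ler_pdivrMr// => h; rewrite lerBlDl. Qed.

Lemma trapezoid_ge0 t : 0 <= trapezoid t.
Proof.
rewrite /trapezoid subr_ge0.
have [tb|tb] := leP t (b - 2 * del).
  rewrite [leLHS]smooth_step_le0.
    by have /andP[] := smooth_step_itv (del^-1 * t + - (del^-1 * a)).
  by have := @ge_scale t b (- 2); have := abdel; have := del0; lra.
rewrite [leRHS]smooth_step_ge2.
  by have /andP[] := smooth_step_itv (del^-1 * t + (2 - del^-1 * b)).
by apply: le_scale; have := abdel; have := del0; lra.
Qed.

Lemma trapezoid_itv t : 0 <= trapezoid t <= 1.
Proof.
rewrite trapezoid_ge0 /trapezoid lerBlDr.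
have /andP[_ s1] := smooth_step_itv (del^-1 * t + - (del^-1 * a)).
have /andP[s0 _] := smooth_step_itv (del^-1 * t + (2 - del^-1 * b)).
by apply: le_trans s1 _; rewrite lerDl.
Qed.

Lemma trapezoid_eq0 t : ~~ (a < t < b) -> trapezoid t = 0.
Proof.
rewrite negb_and -!leNgt /trapezoid => /orP[ta|tb].
  rewrite !smooth_step_le0 ?subrr//.
    by have := @ge_scale t b (-2); have := abdel; have := del0; lra.
  by apply: ge_scale; have := abdel; have := del0; lra.
rewrite !smooth_step_ge2 ?subrr//.
  by have := @le_scale t b 0; have := abdel; have := del0; lra.
by apply: le_scale; have := abdel; have := del0; lra.
Qed.

Lemma trapezoid_eq1 t : a + 2 * del <= t <= b - 2 * del -> trapezoid t = 1.
Proof.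
move=> /andP[ta tb]; rewrite /trapezoid smooth_step_ge2; last first.
  by apply: le_scale; have := abdel; have := del0; lra.
by rewrite smooth_step_le0 ?subr0//; have := @ge_scale t b (-2); have := abdel; have := del0; lra.
Qed.

Lemma trapezoid_slope_ge0 t : t <= b - 2 * del -> 0 <= trapezoid_slope t.
Proof.
move=> tb; rewrite /trapezoid_slope -mulrBr.
rewrite [X in _ - X]hat_eq0 ?subr0; last first.
  rewrite negb_and -!leNgt; apply/orP; left.
  by have := @ge_scale t b (-2); have := abdel; have := del0; lra.
by rewrite mulr_ge0 ?hat_ge0// invr_ge0 ltW.
Qed.

Lemma trapezoid_slope_le0 t : a + 2 * del <= t -> trapezoid_slope t <= 0.
Proof.
move=> ta; rewrite /trapezoid_slope -mulrBr.
rewrite [X in X - _]hat_eq0 ?sub0r; last first.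
  by rewrite negb_and -!leNgt; apply/orP; right; apply: le_scale; have := abdel; have := del0; lra.
by rewrite mulrN oppr_le0 mulr_ge0 ?hat_ge0// invr_ge0 ltW.
Qed.

Lemma trapezoid_slope_eq0 t : ~~ (a < t < b) -> trapezoid_slope t = 0.
Proof.
rewrite negb_and -!leNgt /trapezoid_slope => tab.
rewrite !hat_eq0 ?mulr0 ?subr0// negb_and -!leNgt; apply/orP;
  case/orP: tab => h.
- by left; have := @ge_scale t b (-2); have := abdel; have := del0; lra.
- by right; have := @le_scale t b 0; have := abdel; have := del0; lra.
- by left; apply: ge_scale; have := abdel; have := del0; lra.
- by right; apply: le_scale; have := abdel; have := del0; lra.
Qed.

End trapezoid.

Section mean_value.
Context d (T : measurableType d) (R : realType) (mu : {measure set T -> \bar R}).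
Local Notation L2 := (LspaceType2 mu).
Local Notation leb := (@lebesgue_measure R).
Implicit Types (u g s : R -> L2) (h : L2) (a b K : R).

Lemma simple_fun_dot_measurable s h :
  simple_fun s -> measurable_fun (setT : set (measurableTypeR R))
    (fun t => L2dot (s t) h).
Proof.
move=> [fins ms] _ B mB; rewrite setTI.
have -> : (fun t => L2dot (s t) h) @^-1` B =
    \bigcup_(y in [set y | range s y /\ B (L2dot y h)]) s @^-1` [set y].
  apply/seteqP; split => t /=.
    by move=> Bt; exists (s t) => //; split => //; exists t.
  by move=> [y [_ By]] /= ->.
apply: fin_bigcup_measurable; last by move=> y _; exact: ms.
by apply: sub_finite_set fins => y [].
Qed.

Lemma strongly_measurable_dot g h (D : set (measurableTypeR R))
    (s : nat -> R -> L2) : measurable D ->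
  (forall n, simple_fun (s n)) -> (forall t, D t -> s ^~ t @ \oo --> g t) ->
  measurable_fun D (fun t => L2dot (g t) h).
Proof.
move=> mD ss sg.
apply: (@measurable_fun_cvg _ (measurableTypeR R) R D
  (fun n t => L2dot (s n t) h)).
  by move=> n; apply: measurable_funTS; exact: simple_fun_dot_measurable.
move=> t Dt; apply: (@cvg_comp _ _ _ (s ^~ t) (fun y => L2dot y h : R^o) \oo (nbhs (g t))).
  exact: sg.
exact: L2dot_continuous.
Qed.

Lemma test_fun_trapezoid a b del : 0 < a -> 0 < del -> 4 * del <= b - a ->
  test_fun (trapezoid a b del).
Proof.
move=> a0 del0 abdel; split.
- by move=> t; have := is_derive_trapezoid a b del t; case.
- by rewrite derive1_trapezoid; exact: continuous_trapezoid_slope.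
- exists a, b; split => // t tab; apply: trapezoid_eq0 => //.
  by apply: contra tab => /andP[/ltW -> /ltW ->].
Qed.

Lemma Rintegral_null_support (N E1 E2 : set (measurableTypeR R)) (f : R -> R) :
  measurable N -> leb N = 0%E ->
  (forall t, ~ N t -> f t != 0 -> (t \in E1) = (t \in E2)) ->
  \int[leb]_(t in E1) f t = \int[leb]_(t in E2) f t.
Proof.
move=> mN N0 E12; rewrite Rintegral_mkcond [RHS]Rintegral_mkcond.
congr fine; apply: (integral_null_modification mN N0) => t Nt; congr EFin.
rewrite /patch; have [ft|/(E12 t Nt) ->//] := eqVneq (f t) 0.
by rewrite ft !if_same.
Qed.

(** The integrand is the derivative of trapezoid t * (K * t + c), which vanishes
    at a and b. *)
Lemma trapezoid_by_parts a b del (K c : R) : 0 < del -> 4 * del <= b - a ->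
  \int[leb]_(t in `[a, b]) (trapezoid_slope a b del t * (K * t + c)
    + trapezoid a b del t * K) = 0.
Proof.
move=> del0 abdel.
pose F t := trapezoid a b del t * (K * t + c).
have dF t : is_derive t (1 : R) F
    (trapezoid_slope a b del t * (K * t + c) + trapezoid a b del t * K).
  have dT := is_derive_trapezoid a b del t.
  have dA : is_derive t (1 : R) (fun t : R => K * t + c : R) K.
    apply: is_derive_eq; rewrite /GRing.scale /=; ring.
  apply: is_derive_eq; rewrite /GRing.scale /=; ring.
have cF : continuous F.
  move=> t; apply: differentiable_continuous; apply/derivable1_diffP.
  by case: (dF t).
have cT : continuous (trapezoid a b del).
  move=> t; apply: differentiable_continuous; apply/derivable1_diffP.
  by case: (is_derive_trapezoid a b del t).
have ab : a < b by rewrite -subr_gt0 (lt_le_trans _ abdel)// mulr_gt0.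
have cA : continuous (fun t : R => K * t + c).
  move=> t; apply: cvgD; last exact: cvg_cst.
  by apply: cvgM; [exact: cvg_cst|exact: cvg_id].
rewrite /Rintegral (@continuous_FTC2 _ _ F)//.
- rewrite /F (trapezoid_eq0 del0 abdel) ?(trapezoid_eq0 del0 abdel) ?ltxx ?andbF//.
  by rewrite !mul0r subee.
- apply: continuous_subspaceT => t; apply: cvgD.
    by apply: cvgM; [exact: continuous_trapezoid_slope|exact: cA].
  by apply: cvgM; [exact: cT|exact: cvg_cst].
- split; first by move=> t _; case: (dF t).
    by apply: cvg_at_right_filter; exact: cF.
  by apply: cvg_at_left_filter; exact: cF.
- by move=> t _; rewrite derive1E; have := dF t => ?; rewrite derive_val.
Qed.

Lemma trapezoid_integral_gt0 a b del : 0 < del -> 4 * del < b - a ->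
  0 < \int[leb]_(t in `[a, b]) trapezoid a b del t.
Proof.
move=> del0 abdel'; have abdel := ltW abdel'.
have cT : continuous (trapezoid a b del).
  move=> t; apply: differentiable_continuous; apply/derivable1_diffP.
  by case: (is_derive_trapezoid a b del t).
have sub : `[a + 2 * del, b - 2 * del] `<=` `[a, b].
  by move=> t /=; rewrite !in_itv /= => /andP[h1 h2]; apply/andP; split; lra.
have iT : leb.-integrable `[a, b] (EFin \o trapezoid a b del).
  by apply: continuous_compact_integrable; [exact: segment_compact|exact: continuous_subspaceT].
apply: (@lt_le_trans _ _ (\int[leb]_(t in `[a + 2 * del, b - 2 * del]) trapezoid a b del t)).
  rewrite (@eq_Rintegral _ _ _ leb _ (cst 1)); last first.
    by move=> t; rewrite inE /= in_itv /= => tab; rewrite (trapezoid_eq1 del0 abdel).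
  rewrite Rintegral_cst//= mul1r lebesgue_measure_itv /= lte_fin.
  have -> : a + 2 * del < b - 2 * del by lra.
  by rewrite -EFinB /=; lra.
apply: fine_le.
- apply: integrable_fin_num => //; apply: integrableS iT => //.
- exact: integrable_fin_num.
apply: ge0_subset_integral => //.
- by case/integrableP: iT.
- by move=> t _; rewrite lee_fin trapezoid_ge0.
Qed.

Section proof.
Variables (u g : R -> L2) (h : L2) (a b K : R).
Hypotheses (a0 : 0 < a) (ab : a < b)
  (u_cont : forall t, 0 < t -> {for t, continuous u})
  (g_meas : strongly_measurable g) (ug : weak_derivative u g)
  (g_bounded : exists M : R, {ae leb, forall t, a <= t <= b -> `|g t| <= M})
  (gh_le : {ae leb, forall t, a <= t <= b -> L2dot (g t) h <= K}).

(** A single exceptional set, so that all the integrals of [mean_value_le] can be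
    taken over the same measurable set. *)
Let null_set : exists N : set (measurableTypeR R), [/\ measurable N, leb N = 0%E &
  (exists M : R, forall t, a <= t <= b -> ~ N t -> `|L2dot (g t) h| <= M) /\
  (forall t, a <= t <= b -> ~ N t -> L2dot (g t) h <= K) /\
  (measurable_fun (`[a, b] `\` N : set (measurableTypeR R)) (fun t => L2dot (g t) h))].
Proof.
have [M gM] := g_bounded; have [s [ss sg]] := g_meas.
have Fleb : Filter (almost_everywhere leb) by exact: ae_filter_ringOfSetsType.
have [N [mN N0 NP]] := @filterI _ _ Fleb _ _ (@filterI _ _ Fleb _ _ gM gh_le) sg.
have good t : a <= t <= b -> ~ N t -> [/\ `|g t| <= M, L2dot (g t) h <= K &
    s ^~ t @ \oo --> g t].
  move=> tab Nt; have [[h1 h2] h3] : ((a <= t <= b -> `|g t| <= M) /\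
      (a <= t <= b -> L2dot (g t) h <= K)) /\ (0 < t -> s ^~ t @ \oo --> g t).
    by apply: contrapT => ht; apply: Nt; apply: NP.
  split; [exact: h1|exact: h2|apply: h3].
  by case/andP: tab => at_ _; exact: lt_le_trans at_.
exists N; split; [exact: mN|exact: N0|split; last split].
- exists (M * `|h|) => t tab Nt; have [gtM _ _] := good t tab Nt.
  by apply: le_trans (L2dot_CS _ _) _; rewrite ler_wpM2r.
- by move=> t tab Nt; have [] := good t tab Nt.
- apply: (@strongly_measurable_dot g h _ s) => //.
    exact: measurableD.
  by move=> t [/= tab Nt]; have [] := good t _ Nt; first by rewrite in_itv in tab.
Qed.

(** Suppose that w = <u, h> has w b - w a > K' (b - a) for some K' > K, and put
    W = w - K' t, so that W a < c < W b for the midvalue c.  For a trapezoid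
    psi with steep sides, W < c where psi' > 0 and W > c where psi' < 0, hence
    the integral of psi' w is at most that of psi' (K' t + c), which is - K'
    times the integral of psi.  By the weak derivative identity it is at least
    - K times the integral of psi, a contradiction. *)
Lemma mean_value_le : L2dot (u b - u a) h <= K * (b - a).
Proof.
rewrite leNgt; apply/negP => Kab.
pose w t := L2dot (u t) h.
have ba0 : 0 < b - a by rewrite subr_gt0.
have [K' KK' K'ab] : exists2 K', K < K' & K' * (b - a) < w b - w a.
  have KQ : K < (w b - w a) / (b - a) by rewrite ltr_pdivlMr// /w -L2dotBl.
  exists ((K + (w b - w a) / (b - a)) / 2); first lra.
  rewrite -ltr_pdivlMr//; lra.
have w_cont t : 0 < t -> {for t, continuous (w : R -> R^o)}.
  move=> t0; apply: (@continuous_comp _ _ _ u (fun y => L2dot y h : R^o)).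
    exact: u_cont.
  exact: L2dot_continuous.
pose W t := w t - K' * t.
have W_cont t : 0 < t -> {for t, continuous (W : R -> R^o)}.
  move=> t0; apply: cvgB; first exact: w_cont.
  by apply: cvgM; [exact: cvg_cst|exact: cvg_id].
have Wab : W a < W b by rewrite /W; lra.
pose c := (W a + W b) / 2.
have [Wac Wcb] : W a < c /\ c < W b by rewrite /c; split; lra.
have b0 : 0 < b by exact: lt_trans ab.
have /nbhs_ballP[ea /= ea0 eaW] := W_cont a a0 _ (lt_nbhsl Wac).
have /nbhs_ballP[eb /= eb0 ebW] := W_cont b b0 _ (lt_nbhsr Wcb).
pose m := Num.min (b - a) (Num.min ea eb).
have m0 : 0 < m by rewrite !lt_min ba0 ea0 eb0.
have [mba mea meb] : [/\ m <= b - a, m <= ea & m <= eb].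
  by rewrite /m !ge_min !lexx ?orbT; split.
(* Each side of the trapezoid has length 2 del = m / 4: it stays inside the balls
   where W is compared with c, and 4 del < b - a leaves a plateau. *)
pose del := m / 8.
have del0 : 0 < del by rewrite divr_gt0.
have abdel' : 4 * del < b - a by rewrite /del; lra.
have abdel := ltW abdel'.
have slopeW t : a <= t <= b -> trapezoid_slope a b del t * w t <=
    trapezoid_slope a b del t * (K' * t + c).
  move=> /andP[at_ tb].
  have [ta2|ta2] := leP t (a + 2 * del).
    apply: ler_wpM2l.
      by apply: (trapezoid_slope_ge0 del0 abdel); lra.
    have : W t < c.
      apply: eaW; rewrite /ball /= distrC ger0_norm; last lra.
      by rewrite /del in ta2; lra.
    by rewrite /W; lra.
  have [tb2|tb2] := leP (b - 2 * del) t.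
    apply: ler_wnM2l.
      by apply: (trapezoid_slope_le0 del0 abdel); lra.
    have : c < W t.
      apply: ebW; rewrite /ball /= ger0_norm; last lra.
      by rewrite /del in tb2; lra.
    by rewrite /W; lra.
  suff -> : trapezoid_slope a b del t = 0 by rewrite !mul0r.
  apply/eqP; rewrite eq_le (trapezoid_slope_le0 del0 abdel (ltW ta2)).
  by rewrite (trapezoid_slope_ge0 del0 abdel (ltW tb2)).
have [N [mN N0 [[M gM] [gK mg]]]] := null_set.
pose D : set (measurableTypeR R) := `[a, b] `\` N.
have mD : measurable D by exact: measurableD.
have Dab t : D t -> a <= t <= b by move=> [/=]; rewrite in_itv.
have DN t : D t -> ~ N t by case.
have supp f : (forall t, ~~ (a < t < b) -> f t = 0) ->
    \int[leb]_(t in `]0, +oo[) f t = \int[leb]_(t in D) f t.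
  move=> f0; apply: (@Rintegral_null_support N) => // t Nt ft.
  have /andP[ta tb] : a < t < b by apply: contraNT ft => /f0 ->.
  transitivity true.
    by apply/mem_set => /=; rewrite in_itv /= andbT (lt_trans a0).
  by apply/esym/mem_set; split => //=; rewrite in_itv /= !ltW.
have suppab f : \int[leb]_(t in `[a, b]) f t = \int[leb]_(t in D) f t.
  apply: (@Rintegral_null_support N) => // t Nt _.
  apply/idP/idP => /set_mem tab; apply/mem_set; first by split.
  by case: tab.
have cab (f : R -> R) : (forall t, a <= t <= b -> {for t, continuous (f : R -> R^o)}) ->
    leb.-integrable D (EFin \o f).
  move=> fc; apply: (@integrableS _ _ _ leb `[a, b]) => //.
  apply: continuous_compact_integrable; first exact: segment_compact.
  by apply: continuous_in_subspaceT => t; rewrite inE /= in_itv; exact: fc.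
have cS := @continuous_trapezoid_slope R a b del.
have cT : continuous (trapezoid a b del).
  move=> t; apply: differentiable_continuous; apply/derivable1_diffP.
  by case: (is_derive_trapezoid a b del t).
have iTG : leb.-integrable D (EFin \o (fun t => trapezoid a b del t * L2dot (g t) h)).
  apply: measurable_bounded_integrable => //.
  - apply: (@le_lt_trans _ _ (leb `[a, b])); last first.
      by rewrite lebesgue_measure_itv /= lte_fin ab -EFinB ltry.
    by apply: le_measure; rewrite ?inE// => t [].
  - apply: measurable_funM; last exact: mg.
    by apply: measurable_funTS; exact: continuous_measurable_fun.
  - exists `|M|; split; first exact: num_real.
    move=> x Mx t Dt; rewrite /= normrM.
    have /andP[T0 T1] := trapezoid_itv del0 abdel t.
    rewrite ger0_norm//; apply: le_trans (ltW (le_lt_trans (ler_norm M) Mx)).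
    apply: le_trans (gM t (Dab t Dt) (DN t Dt)).
    by rewrite ler_piMl.
have iT : leb.-integrable D (EFin \o trapezoid a b del) by apply: cab => t _; exact: cT.
have iSw : leb.-integrable D (EFin \o (fun t => trapezoid_slope a b del t * w t)).
  apply: cab => t /andP[at_ _]; apply: cvgM; first exact: cS.
  by apply: w_cont; exact: lt_le_trans at_.
have iSA : leb.-integrable D
    (EFin \o (fun t => trapezoid_slope a b del t * (K' * t + c))).
  apply: cab => t _; apply: cvgM; first exact: cS.
  apply: cvgD; last exact: cvg_cst.
  by apply: cvgM; [exact: cvg_cst|exact: cvg_id].
have iTK k : leb.-integrable D (EFin \o (fun t => trapezoid a b del t * k)).
  by apply: cab => t _; apply: cvgM; [exact: cT|exact: cvg_cst].
have := ug (test_fun_trapezoid a0 del0 abdel) h.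
rewrite derive1_trapezoid supp; last first.
  by move=> t tab; rewrite (trapezoid_slope_eq0 del0 abdel)// mul0r.
rewrite supp; last first.
  by move=> t tab; rewrite (trapezoid_eq0 del0 abdel)// mul0r.
have SwSA : \int[leb]_(t in D) (trapezoid_slope a b del t * w t) <=
    \int[leb]_(t in D) (trapezoid_slope a b del t * (K' * t + c)).
  by apply: le_Rintegral => // t Dt; exact: slopeW (Dab _ Dt).
have TGK : \int[leb]_(t in D) (trapezoid a b del t * L2dot (g t) h) <=
    \int[leb]_(t in D) (trapezoid a b del t * K).
  apply: le_Rintegral => // t Dt; apply: ler_wpM2l; last exact: gK (Dab _ Dt) (DN _ Dt).
  exact: trapezoid_ge0.
have := @trapezoid_by_parts a b del K' c del0 abdel.
rewrite suppab RintegralD// !RintegralZr// in TGK *.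
have := trapezoid_integral_gt0 del0 abdel'; rewrite suppab.
move: SwSA TGK; rewrite /w.
set A := \int[leb]_(t in D) _; set C := \int[leb]_(t in D) (_ * (_ + _)).
set B := \int[leb]_(t in D) (_ * L2dot _ _).
set P := \int[leb]_(t in D) trapezoid a b del t.
by move=> AC BK P0 CP AB; nra.
Qed.

End proof.
End mean_value.

(** * Dissipation along trajectories *)

Section cone_projection.
Context d (T : measurableType d) (R : realType) (mu : {measure set T -> \bar R}).
Local Notation L2 := (LspaceType2 mu).
Implicit Types u v w z : L2.

Lemma L2neg_lipschitz u v : `|L2neg u - L2neg v| <= `|u - v|.
Proof.
have posneg z : z = L2pos z - L2neg z by rewrite /L2neg opprB addrC subrK.
rewrite -ler_sqr ?nnegrE//.
have -> : u - v = (L2pos u - L2pos v) - (L2neg u - L2neg v).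
  by rewrite {1}(posneg u) {1}(posneg v) !opprD !opprK addrACA.
have := L2dot_ge0 (L2nonneg_pos u) (L2nonneg_neg v).
have := L2dot_ge0 (L2nonneg_pos v) (L2nonneg_neg u).
have := L2dot_pos_neg u; have := L2dot_pos_neg v.
move: (L2pos u) (L2pos v) (L2neg u) (L2neg v) => p p' n n'.
rewrite (L2normB_sqr (p - p')) !(L2dotBl, L2dotBr).
have := sqr_ge0 `|p - p'|; lra.
Qed.

(** Convexity of |u-|^2 / 2, whose gradient is - u-. *)
Lemma L2neg_sqr_increment u v :
  `|L2neg u| ^+ 2 / 2 - `|L2neg v| ^+ 2 / 2 <= L2dot (u - v) (- L2neg u).
Proof.
have posE z : L2pos z = z + L2neg z by rewrite /L2neg addrC subrK.
have : L2dot (u + L2neg u) (L2neg u) = 0 by rewrite -posE L2dot_pos_neg.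
have : 0 <= L2dot (v + L2neg v) (L2neg u).
  rewrite -posE; apply: L2dot_ge0; first exact: L2nonneg_pos.
  exact: L2nonneg_neg.
move: (L2neg u) (L2neg v) => n n'; have := sqr_ge0 `|n - n'|.
rewrite (L2normB_sqr n) L2dotNr L2dotBl !L2dotDl L2dotuu (L2dotC n'); lra.
Qed.

Lemma sqr_dist_increment u v z :
  `|u - z| ^+ 2 / 2 - `|v - z| ^+ 2 / 2 <= L2dot (u - v) (u - z).
Proof.
have -> : u - v = (u - z) - (v - z) by rewrite opprB addrA subrK.
move: (u - z) (v - z) => x y; have := sqr_ge0 `|x - y|.
rewrite L2normB_sqr L2dotBl L2dotuu (L2dotC y); lra.
Qed.

(** The positive part is the projection onto the positive cone. *)
Lemma cone_dist_le w u : L2nonneg w -> `|L2pos u - u| <= `|w - u|.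
Proof.
move=> w0; rewrite -ler_sqr ?nnegrE//.
have -> : w - u = (w - L2pos u) + (L2pos u - u) by rewrite addrA subrK.
rewrite (L2normD_sqr (w - L2pos u)) -/(L2neg u).
rewrite (L2dotBl w (L2pos u)) L2dot_pos_neg.
have := L2dot_ge0 w0 (L2nonneg_neg u).
have := sqr_ge0 `|w - L2pos u|; lra.
Qed.

End cone_projection.

Section dissipation.
Context d (T : measurableType d) (R : realType) (mu : {measure set T -> \bar R}).
Local Notation L2 := (LspaceType2 mu).
Local Notation leb := (@lebesgue_measure R).
Variables (u g : R -> L2).
Hypotheses (u_cont : forall t, 0 < t -> {for t, continuous u})
  (ug : W1infty_loc u g).

Let Fleb : Filter (nbhs (almost_everywhere leb)).
Proof. exact: ae_filter_ringOfSetsType. Qed.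

Lemma W1infty_increment h a b K : 0 < a -> a < b ->
  {ae leb, forall t, a <= t <= b -> L2dot (g t) h <= K} ->
  L2dot (u b - u a) h <= K * (b - a).
Proof.
have [_ [gm gb] wd] := ug; move=> a0 ab gK.
apply: (mean_value_le a0 ab u_cont gm wd _ gK).
exact: gb.
Qed.

(** Here n is the gradient of Q along u, and the hypothesis on Q is the convexity
    inequality for the increment.  On [s, t] the function n is frozen at t.  If M
    bounds |g| on [a, b], then u and n have Lipschitz constant M, and
    <g r, n t> <= - eps + M^2 (t - s) for almost every r in [s, t]. *)
Lemma W1infty_dissipation (n : R -> L2) (Q : R -> R) eps a b : 0 < a -> a <= b ->
  (forall s t, a <= s -> t <= b -> `|n t - n s| <= `|u t - u s|) ->
  (forall s t, a <= s -> t <= b -> Q t - Q s <= L2dot (u t - u s) (n t)) ->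
  {ae leb, forall t, a <= t <= b -> L2dot (g t) (n t) <= - eps} ->
  Q b - Q a <= - eps * (b - a).
Proof.
move=> a0 ab nu Qn gn; have Fl := Fleb.
have [->|ab'] := eqVneq a b; first by rewrite !subrr mulr0.
have {ab'}ab' : a < b by rewrite lt_neqAle ab'.
have [_ [_ gb] _] := ug; have [M' gM'] := gb a b a0 ab'.
pose M := `|M'|; have M0 : 0 <= M by exact: normr_ge0.
have gM : {ae leb, forall t, a <= t <= b -> `|g t| <= M}.
  by apply: filterS gM' => t h /h /le_trans; apply; exact: ler_norm.
have lip s t : a <= s -> s < t -> t <= b -> `|u t - u s| <= M * (t - s).
  move=> as_ st tb; set h := u t - u s.
  have [->|h0] := eqVneq h 0; first by rewrite normr0 mulr_ge0// subr_ge0 ltW.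
  have s0 : 0 < s by exact: lt_le_trans as_.
  have : L2dot (u t - u s) h <= (M * `|h|) * (t - s).
    apply: W1infty_increment => //; apply: filterS gM => r gr /andP[sr rt].
    apply: le_trans (L2dot_le _ _) _; rewrite ler_wpM2r// gr//.
    by rewrite (le_trans as_ sr) (le_trans rt tb).
  rewrite L2dotuu expr2 mulrAC ler_pM2r//.
  by rewrite normr_gt0.
apply: (@quadratic_increment_le _ Q a b eps (M ^+ 2)) => // s t as_ st tb.
have [->|st'] := eqVneq s t; first by rewrite !subrr mulr0 expr0n mulr0 addr0.
have {st'}st' : s < t by rewrite lt_neqAle st'.
have s0 : 0 < s by exact: lt_le_trans as_.
apply: le_trans (Qn s t as_ tb) _.
have -> : - eps * (t - s) + M ^+ 2 * (t - s) ^+ 2 =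
    (- eps + M ^+ 2 * (t - s)) * (t - s) by ring.
apply: W1infty_increment => //; apply: filterS2 gM gn => r gr gnr /andP[sr rt].
have rab : a <= r <= b by rewrite (le_trans as_ sr) (le_trans rt tb).
have -> : n t = n r + (n t - n r) by rewrite addrC subrK.
rewrite L2dotDr lerD ?gnr//.
apply: le_trans (L2dot_le _ _) _; rewrite expr2 -mulrA.
apply: ler_pM => //; first exact: gr.
have [->|rt'] := eqVneq r t; first by rewrite subrr normr0 mulr_ge0// subr_ge0 ltW.
have {rt'}rt' : r < t by rewrite lt_neqAle rt'.
have /andP[ar rb] := rab.
apply: le_trans (nu r t ar tb) _.
apply: le_trans (lip r t ar rt' tb) _.
by rewrite ler_wpM2l// lerB.
Qed.

End dissipation.

(** * Positivity of the semigroup *)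

Section positivity.
Context d (T : measurableType d) (R : realType) (mu : {measure set T -> \bar R}).
Local Notation L2 := (LspaceType2 mu).
Local Notation leb := (@lebesgue_measure R).
Context (V : lmodType R) (j : V -> L2) (phi : V -> \bar R) (phiH : L2 -> \bar R).
Hypothesis phiHP : is_phiH j phi phiH.
Implicit Types (u v w : L2).

Let phiHNy u : phiH u != -oo%E. Proof. by case: phiHP => _ [+ _] _ _; exact. Qed.

Lemma halfline_continuous (w : R -> L2) : {within `[0, +oo[, continuous w} ->
  (forall t, 0 < t -> {for t, continuous w}) /\
  (forall e, 0 < e -> exists2 del, 0 < del &
    forall t, 0 <= t -> t < del -> `|w t - w 0| < e).
Proof.
move=> /subspace_continuousP cw; split=> [t t0 U wU|e e0].
  have tpos : [set` `[0, +oo[] t by rewrite /= in_itv /= andbT ltW.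
  have := cw t tpos U wU; rewrite /nbhs /= /within /=.
  have := lt_nbhsr t0; apply: filterS2 => s s0; apply.
  by rewrite in_itv /= andbT ltW.
have zpos : [set` `[(0:R), +oo[] 0 by rewrite /= in_itv /= lexx.
have /nbhs_ballP[del /= del0 delP] := cw 0 zpos _ (nbhsx_ballx (w 0) e e0).
exists del => // t t0 tdel.
have : ball (w 0) e (w t).
  apply: delP; first by rewrite /ball /= sub0r normrN ger0_norm.
  by rewrite /= in_itv /= t0.
by rewrite -ball_normE /= -normrN opprB.
Qed.

Lemma solution_subgradient u0 (w : R -> L2) : is_solution j phi u0 w ->
  exists g, W1infty_loc w g /\ {ae leb, forall t, 0 < t ->
    effdom phiH (w t) /\
    forall v, (phiH (w t) + (L2dot (- g t) (v - w t))%:E <= phiH v)%E}.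
Proof.
move=> [_ _ [g [wg gsub]]]; exists g; split => //.
have Fl : Filter (nbhs (almost_everywhere leb)) by exact: ae_filter_ringOfSetsType.
apply: filterS gsub => t /= + t0 => /(_ t0) sub.
have [Hconv _ _ Hsub] := phiHP.
by have [? <-] := (j_subgradP (j := id) (fun _ _ _ => erefl) Hconv phiHNy _ _).1
  (Hsub _ sub).
Qed.

(** The inclusion - g in the subgradient at w, tested at the positive part of w,
    gives <g, w-> >= 0, so that |w-|^2 / 2 does not increase on ]0, t]; near 0 it
    is small by continuity.  Time 0 itself is excluded because the derivative is
    bounded only away from 0. *)
Lemma solution_nonneg u0 (w : R -> L2) :
  (forall u, (phiH (L2pos u) <= phiH u)%E) ->
  is_solution j phi u0 w -> L2nonneg u0 -> forall t, 0 <= t -> L2nonneg (w t).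
Proof.
move=> Hpos sol u0pos t.
have [g [wg gsub]] := solution_subgradient sol.
have [cw w0 _] := sol; have [wcont wcont0] := halfline_continuous cw.
rewrite le_eqVlt => /predU1P[<-|t0]; first by rewrite w0.
have Fl : Filter (nbhs (almost_everywhere leb)) by exact: ae_filter_ringOfSetsType.
have negdec a : 0 < a -> a <= t ->
    `|L2neg (w t)| ^+ 2 / 2 <= `|L2neg (w a)| ^+ 2 / 2.
  move=> a0 at_; rewrite -subr_le0.
  have := @W1infty_dissipation _ _ _ _ w g wcont wg (fun t => - L2neg (w t))
    (fun t => `|L2neg (w t)| ^+ 2 / 2) 0 a t a0 at_.
  rewrite oppr0 mul0r; apply.
  - by move=> s r _ _; rewrite -opprD normrN; exact: L2neg_lipschitz.
  - by move=> s r _ _; exact: L2neg_sqr_increment.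
  - apply: filterS gsub => r /= + /andP[ar _].
    move=> /(_ (lt_le_trans a0 ar))[wdom /(_ (L2pos (w r)))].
    rewrite -/(L2neg (w r)) => /le_trans/(_ (Hpos _)).
    have [p ->] := effdomP phiHNy wdom.
    by rewrite -EFinD lee_fin gerDl L2dotNl L2dotNr.
suff : L2neg (w t) = 0.
  move=> /eqP; rewrite subr_eq0 => /eqP <-; exact: L2nonneg_pos.
apply/eqP; rewrite -normr_eq0 eq_le normr_ge0 andbT.
apply/ler_addgt0Pr => e e0; rewrite add0r.
have [del del0 wdel] := wcont0 e e0.
pose a := Num.min t (del / 2).
have a0 : 0 < a by rewrite lt_min t0 divr_gt0.
have at_ : a <= t by rewrite ge_min lexx.
have adel : a < del.
  apply: (@le_lt_trans _ _ (del / 2)); first by rewrite ge_min lexx orbT.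
  by rewrite ltr_pdivrMr// ltr_pMr// ltr1n.
have neg0 : L2neg (w 0) = 0 by rewrite /L2neg w0 L2pos_id// subrr.
have : `|L2neg (w a)| <= e.
  have := L2neg_lipschitz (w a) (w 0); rewrite neg0 subr0 => /le_trans; apply.
  by rewrite ltW// wdel// ltW.
apply: le_trans; rewrite -ler_sqr ?nnegrE//.
by have := negdec a a0 at_; lra.
Qed.

(** If phiH u < phiH (u+), the trajectory from v = u+ satisfies
    |w b - u|^2 / 2 <= |w a - u|^2 / 2 - eps (b - a) for 0 < a <= b small, which
    contradicts |v - u| <= |w b - u| when a tends to 0. *)
Lemma positive_functional (S : R -> L2 -> L2) u :
  positive_semigroup S -> is_solution j phi (L2pos u) (S ^~ (L2pos u)) ->
  (phiH (L2pos u) <= phiH u)%E.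
Proof.
move=> Spos sol; set v := L2pos u; pose w t := S t v.
have [g [wg gsub]] := solution_subgradient sol.
have [cw w0 _] := sol; have [wcont wcont0] := halfline_continuous cw.
have Fl : Filter (nbhs (almost_everywhere leb)) by exact: ae_filter_ringOfSetsType.
rewrite leNgt; apply/negP => uv.
have [q uq] : exists q, phiH u = q%:E.
  by apply: (effdomP phiHNy); rewrite /effdom /=; exact: lt_le_trans uv (leey _).
have [c qc cv] : exists2 c : R, q < c & (c%:E < phiH v)%E.
  move: uv; rewrite uq; have := phiHNy v; case: (phiH v) => [p| |]//= _.
    rewrite lte_fin => qp; exists ((q + p) / 2); rewrite ?lte_fin; lra.
  by move=> _; exists (q + 1); [lra|exact: ltry].
have [_ _ Hlsc _] := phiHP; have [A vA Ac] := Hlsc _ _ cv.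
have /nbhs_ballP[e /= e0 eA] := vA.
have [del del0 wdel] := wcont0 e e0; rewrite w0 in wdel.
pose b := del / 2; have b0 : 0 < b by rewrite divr_gt0.
have bdel : b < del by rewrite /b; lra.
pose eps := c - q; have eps0 : 0 < eps by rewrite subr_gt0.
have dec a : 0 < a -> a <= b -> `|w b - u| ^+ 2 / 2 - `|w a - u| ^+ 2 / 2
    <= - eps * (b - a).
  move=> a0 ab; apply: (@W1infty_dissipation _ _ _ _ w g wcont wg
      (fun t => w t - u) (fun t => `|w t - u| ^+ 2 / 2)) => //.
  - by move=> s r _ _; rewrite opprB addrA subrK.
  - by move=> s r _ _; exact: sqr_dist_increment.
  - apply: filterS gsub => r /= + /andP[ar rb].
    have r0 := lt_le_trans a0 ar.
    move=> /(_ r0)[wdom /(_ u)]; rewrite uq.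
    have cr : (c%:E < phiH (w r))%E.
      apply: Ac; apply: eA; rewrite -ball_normE /= -normrN opprB.
      by apply: wdel; [exact: ltW|exact: le_lt_trans bdel].
    move: cr; rewrite -/(w r); have [p ->] := effdomP phiHNy wdom.
    rewrite -EFinD lte_fin lee_fin L2dotNl -[u - w r]opprB L2dotNr /eps; lra.
have vb : `|v - u| <= `|w b - u|.
  by apply: cone_dist_le; apply: Spos; [exact: ltW|exact: L2nonneg_pos].
pose N := `|v - u|; have N0 : 0 <= N by exact: normr_ge0.
(* If |w a - u| <= N + eta, with N = |v - u|, the loss eps (b - a) >= eps b / 2
   would have to be at most eta N + eta^2 / 2, which is less than eps b / 4
   for this eta. *)
pose eta := Num.min 1 (eps * b / (4 * (N + 1))).
have N1 : 0 < 4 * (N + 1) by lra.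
have eta0 : 0 < eta by rewrite lt_min ltr01 divr_gt0// mulr_gt0.
have eta1 : eta <= 1 by rewrite ge_min lexx.
have etaN : eta * (4 * (N + 1)) <= eps * b.
  by rewrite -ler_pdivlMr// ge_min lexx orbT.
have [del' del'0 wdel'] := wcont0 eta eta0; rewrite w0 in wdel'.
pose a := Num.min (b / 2) (del' / 2).
have a0 : 0 < a by rewrite lt_min !divr_gt0.
have ab : a <= b / 2 by rewrite ge_min lexx.
have adel : a < del'.
  by apply: (@le_lt_trans _ _ (del' / 2)); [rewrite ge_min lexx orbT|lra].
have wa : `|w a - u| <= N + eta.
  rewrite -[w a - u](subrKA v) addrC (le_trans (ler_normD _ _))// lerD2l.
  by rewrite ltW// wdel'// ltW.
have := dec a a0 ltac:(lra).
have : N ^+ 2 <= `|w b - u| ^+ 2 by rewrite ler_sqr ?nnegrE.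
have : `|w a - u| ^+ 2 <= (N + eta) ^+ 2 by rewrite ler_sqr ?nnegrE// addr_ge0// ltW.
have : eps * (b / 2) <= eps * (b - a) by rewrite ler_pM2l//; lra.
have : eta * eta <= eta by rewrite ger_pMl.
have : 0 < eps * b by rewrite mulr_gt0.
rewrite sqrrD; lra.
Qed.

End positivity.

Theorem theorem3p4 (R : realType) (d : measure_display) (T : measurableType d)
    (mu : {measure set T -> \bar R}) (V : tvsType R)
    (j : {linear V -> LspaceType2 mu}) (phi : V -> \bar R)
    (phiH : LspaceType2 mu -> \bar R)
    (S : R -> LspaceType2 mu -> LspaceType2 mu)
    (j_continuous : weak_to_weak_continuous j)
    (phi_convex : convex_functional phi)
    (phi_proper : proper_functional phi)
    (phi_lsc : lower_semicontinuous phi)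
    (phi_elliptic : j_elliptic j phi)
    (j_dense : dense (j @` effdom phi))
    (phiHP : is_phiH j phi phiH)
    (S_generated : generated_by j phi S) :
  (positive_semigroup S <-> forall u, (phiH (L2pos u) <= phiH u)%E) /\
  ((forall u, (phiH (L2pos u) <= phiH u)%E) <->
   forall uh, effdom phi uh ->
     exists vh, [/\ effdom phi vh, L2pos (j uh) = j vh & (phi vh <= phi uh)%E]).
Proof.
have sol u : is_solution j phi u (S ^~ u).
  apply: S_generated => B; rewrite nbhsE => -[U [Uo Uu] UB].
  have [v [Uv jv]] := j_dense U (ex_intro _ u Uu) Uo.
  by exists v; split => //; exact: UB.
have [omega [omega0 [_ phi_coercive]]] := phi_elliptic.
have phiNy := phi_proper.1.
have phiHNy u : phiH u != -oo%E by case: phiHP => _ [+ _] _ _; exact.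
have ok0 : omega / 2 < omega / 2 + 1 by rewrite ltrDl.
have [c [Hle Hge]] := phiH_is_infimum j_continuous phi_convex phi_proper phi_lsc
  phiHP omega0 phi_coercive ok0.
split; split.
- by move=> Spos u; exact: (positive_functional phiHP Spos (sol _)).
- move=> Hpos t u t0 upos; exact: (solution_nonneg phiHP Hpos (sol u) upos t0).
- move=> Hpos uh ud; have [p up] := effdomP phiNy ud.
  have Hp := le_trans (Hpos (j uh)) (Hle _ _ up).
  have [q vq] : exists q, phiH (L2pos (j uh)) = q%:E.
    by apply: (effdomP phiHNy); exact: le_lt_trans Hp (ltry _).
  have [vh jvh vhq] := Hge _ _ vq; exists vh; split => //.
    exact: le_lt_trans vhq (ltry _).
  by apply: le_trans vhq _; rewrite up lee_fin lerBlDr -lee_fin -vq.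
- move=> Hlift u; have [->|uy] := eqVneq (phiH u) +oo%E; first exact: leey.
  have [q uq] : exists q, phiH u = q%:E.
    by apply: (effdomP phiHNy); rewrite /effdom /= ltey.
  have [uh juh uhq] := Hge _ _ uq.
  have [vh [vd + vu]] := Hlift uh (le_lt_trans uhq (ltry _)).
  rewrite juh => ->.
  have [p vp] := effdomP phiNy vd.
  apply: le_trans (Hle _ _ vp) _; rewrite uq lee_fin -lerBrDr -lee_fin -vp.
  exact: le_trans vu uhq.
Qed.
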